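(* Let $V$ be a finite set with $N=|V|\ge 1$ elements, and let $q:V\times V\to\mathbb{C}$ be an integrable, Hermitian weight with matrix $Q=(q_{uv}:u,v\in V)$. Let $G=(I-Q)^{-1}$, and let $Z=(Z_v)_{v\in V}$ be the complex Gaussian free field on $V$ with covariance matrix $G$. Then the continuous occupation field $\nu_n$ induced by $q$ (a measure on $\mathbb{R}_+^N$) has the same distribution as $|Z|^2=(\overline{Z_v}Z_v)_{v\in V}$; that is, $\nu_n$ is the law of the random vector $|Z|^2$.
   Context: $\mathbb{N}=\{0,1,2,\dots\}$, $\mathbb{R}_+=[0,\infty)$. $V$ is the vertex set of a finite complete digraph with directed edges $V\times V$ (self-edges allowed). A weight is a function $q:V\times V\to\mathbb{C}$, written $q_{uv}=q(u,v)$, with matrix $Q=(q_{uv})$. It is Hermitian if $Q$ is a Hermitian matrix, and integrable if the spectral radius of the matrix of absolute values $|Q|=(|q_{uv}|)$ is strictly less than $1$. For an integrable Hermitian weight, $G=(I-Q)^{-1}$ is a positive definite Hermitian matrix. Complex Gaussian free field. The (discrete centered) complex Gaussian free field on $V$ with covariance $G$ is the random vector $Z\in\mathbb{C}^N$ with density $$f_Z(\boldsymbol{z})=\frac{\exp\{-\langle\boldsymbol{z},G^{-1}\boldsymbol{z}\rangle\}}{\pi^N\det G},\qquad \boldsymbol{z}\in\mathbb{C}^N,$$ with respect to Lebesgue measure on $\mathbb{C}^N$, where $\langle\boldsymbol{z},G^{-1}\boldsymbol{z}\rangle=\sum_{u,v\in V}\overline{z_u}\,(G^{-1})_{uv}\,z_v$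 is the standard Hermitian form. Paths and loops. A path of length $|\omega|=k$ in $V$ is a sequence $\omega=(\omega^0,\dots,\omega^k)$ of vertices; its weight is $q(\omega)=\prod_{j=1}^k q_{\omega^{j-1}\omega^j}$ (equal to $1$ if $k=0$). A rooted loop is a path with $\omega^0=\omega^k$; it is nontrivial if $k>0$. The vertex local time of $\omega$ is $n_u(\omega)=\#\{1\le j\le k:\omega^j=u\}$, $u\in V$. An (oriented) unrooted loop is an equivalence class $l$ of nontrivial rooted loops under cyclic permutations $(\omega^0,\omega^1,\dots,\omega^k=\omega^0)\sim(\omega^1,\dots,\omega^{k-1},\omega^0,\omega^1)\sim\cdots$. The set of unrooted loops is $\mathcal{L}$. For $l\in\mathcal{L}$, $q(l)$ and $n_u(l)$ are defined as $q(\omega)$ and $n_u(\omega)$ for any representative $\omega\in l$. Loop measure and loop soup. The unrooted loop measure is $m(l)=\sum_{\omega\in l}\frac{q(\omega)}{|\omega|}=\frac{q(l)}{d(l)}$, where $d(l)$ is the largest integer $d$ such that every representative of $l$ is a concatenation of $d$ identical loops; for integrable $q$ this is a complex measure on $\mathcal{L}$, with total mass $m(\mathcal{L})=\sum_{l\in\mathcal{L}}m(l)$. Let $\mathbb{N}^{\mathcal{L}}_{\mathrm{fin}}$ be the set of finitely supported functions $\boldsymbol{s}=(s_l)_{l\in\mathcal{L}}:\mathcal{L}\to\mathbb{N}$ (finite multisets of unrooted loops), and $n_u(\boldsymbol{s})=\sum_l s_l\,n_u(l)$. The loop soup at intensity $1$ is the complex measure on $\mathbb{N}^{\mathcal{L}}_{\mathrm{fin}}$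 given by $$\nu_m\{\boldsymbol{s}\}=e^{-m(\mathcal{L})}\prod_{l\in\mathcal{L}}\frac{m(l)^{s_l}}{s_l!}.$$ Continuous occupation field. The continuous occupation field $\nu_n$ is obtained from the discrete occupation field $(n_u(\boldsymbol{s}))_{u\in V}$ by independently replacing $n_u$ at each vertex $u$ with a sum of $n_u+1$ independent mean-one exponential random variables; that is, $\nu_n$ is the measure on $\mathbb{R}_+^N$ with density with respect to Lebesgue measure $\lambda_N$ $$\frac{d\nu_n}{d\lambda_N}(\boldsymbol{t})=\sum_{\boldsymbol{s}\in\mathbb{N}^{\mathcal{L}}_{\mathrm{fin}}}\left[\nu_m\{\boldsymbol{s}\}\prod_{u\in V}\frac{t_u^{n_u(\boldsymbol{s})}e^{-t_u}}{n_u(\boldsymbol{s})!}\right],\qquad \boldsymbol{t}=(t_u)_{u\in V}\in\mathbb{R}_+^N.$$ *)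

(* Defs.v *)
From HB Require Import structures.
From mathcomp Require Import all_boot all_order all_algebra finmap.
From mathcomp Require Import spectral sesquilinear complex.
From mathcomp Require Import all_classical all_reals all_analysis.

Set Implicit Arguments.
Unset Strict Implicit.
Unset Printing Implicit Defensive.
Import Order.TTheory GRing.Theory Num.Theory.
Import numFieldNormedType.Exports.

Local Open Scope classical_set_scope.
Local Open Scope ring_scope.
Local Open Scope complex_scope.

Definition cexp (R : realType) (z : R[i]) : R[i] :=
  (expR (complex.Re z))%:C * (cos (complex.Im z) +i* sin (complex.Im z)).

(* Unordered sums of real and complex families: the positive and negative parts
   of the real and imaginary parts are summed separately. This is the sum of the
   family as soon as [csummable] holds, and is meaningless otherwise. *)
Definition csummable (R : realType) (I : choiceType) (f : I -> R[i]) : Prop :=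
  summable [set: I] (fun i => (Normc.normc (f i))%:E).

Definition rsum (R : realType) (I : choiceType) (f : I -> R) : R :=
  fine (\esum_(i in [set: I]) ((EFin \o f)^\+ i)%E)
  - fine (\esum_(i in [set: I]) ((EFin \o f)^\- i)%E).

Definition csum (R : realType) (I : choiceType) (f : I -> R[i]) : R[i] :=
  rsum (fun i => complex.Re (f i)) +i* rsum (fun i => complex.Im (f i)).

Section complex_integral.
Context d (T : measurableType d) (R : realType).

Definition cintegrable (mu : {measure set T -> \bar R}) (D : set T)
    (f : T -> R[i]) : Prop :=
  mu.-integrable D (fun x => (complex.Re (f x))%:E) /\
  mu.-integrable D (fun x => (complex.Im (f x))%:E).

Definition cintegral (mu : {measure set T -> \bar R}) (D : set T)
    (f : T -> R[i]) : R[i] :=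
  Rintegral mu D (fun x => complex.Re (f x))
  +i* Rintegral mu D (fun x => complex.Im (f x)).

End complex_integral.

(* [measurableTypeR R] is R with the Borel sigma-algebra on which
   [lebesgue_measure] is defined. *)
Notation realvec R N := (N.-tuple (measurableTypeR R)).

Definition vcoord (R : realType) (N : nat) (t : realvec R N) (i : 'I_N) : R :=
  tnth t i.

(* Lebesgue measure on R^N, by R^0 = {[tuple]} and R^(N+1) = R x R^N. *)
Definition consvec (R : realType) (N : nat)
    (p : measurableTypeR R * realvec R N) : realvec R N.+1 :=
  [tuple of p.1 :: p.2].

Lemma measurable_consvec (R : realType) (N : nat) :
  measurable_fun [set: measurableTypeR R * realvec R N] (@consvec R N).
Proof.
by apply: measurable_cons; [exact: measurable_fst|exact: measurable_snd].
Qed.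

Section lebesgue_cons.
Context (R : realType) (N : nat).
Context (mu : {sigma_finite_measure set (realvec R N) -> \bar R}).

Definition lebesgue_cons : set (realvec R N.+1) -> \bar R :=
  pushforward (lebesgue_measure \x mu)%E (@consvec R N).

HB.instance Definition _ := Measure.copy lebesgue_cons
  (measure_function_pushforward__canonical__measure_function_Measure
     (lebesgue_measure \x mu)%E (@measurable_consvec R N)).

Let sigma_finite_lebesgue_cons : sigma_finite setT lebesgue_cons.
Proof.
have /sigma_finiteP[F [FT ndF Foo]] :=
  sigma_finiteT (@lebesgue_measure R).
have /sigma_finiteP[G [GT ndG Goo]] := sigma_finiteT mu.
pose uncons (t : realvec R N.+1) := (thead t, [tuple of behead t]).
have muncons : measurable_fun setT uncons.
  by apply/measurable_fun_pair; [exact: measurable_tnth|exact: measurable_behead].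
have unconsK (p : measurableTypeR R * realvec R N) : uncons (consvec p) = p.
  by case: p => x t; congr pair; apply: val_inj.
exists (fun n => uncons @^-1` (F n `*` G n)).
  rewrite -preimage_bigcup; apply/esym/seteqP; split=> // t _.
  have [n _ Fn] : (\bigcup_i F i) (uncons t).1 by rewrite -FT.
  have [m _ Gm] : (\bigcup_i G i) (uncons t).2 by rewrite -GT.
  exists (maxn n m) => //; split.
    by move: Fn; exact/subsetPset/ndF/leq_maxl.
  by move: Gm; exact/subsetPset/ndG/leq_maxr.
move=> n; have [mF Fn] := Foo n; have [mG Gn] := Goo n; split.
  by rewrite -[X in measurable X]setTI; apply: muncons => //; exact: measurableX.
rewrite /lebesgue_cons /pushforward -comp_preimage.
rewrite (_ : uncons \o _ = id) ?preimage_id; last by apply/funext => p /=.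
by rewrite product_measure1E// lte_mul_pinfty// ge0_fin_numE.
Qed.

HB.instance Definition _ := @Measure_isSigmaFinite.Build _ _ _
  lebesgue_cons sigma_finite_lebesgue_cons.

End lebesgue_cons.

Fixpoint lebesgue_vec (R : realType) (N : nat) :
    {sigma_finite_measure set (realvec R N) -> \bar R} :=
  match N return {sigma_finite_measure set (realvec R N) -> \bar R} with
  | 0 => @dirac _ (realvec R 0) [tuple] R
  | N'.+1 => lebesgue_cons (lebesgue_vec R N')
  end.

(* C^N is represented as R^N x R^N (real and imaginary parts), so that Lebesgue
   measure on C^N is [lebesgue_vec R N \x lebesgue_vec R N]. *)
Definition cvec (R : realType) (N : nat) (xy : realvec R N * realvec R N) :
    'I_N -> R[i] :=
  fun i => vcoord xy.1 i +i* vcoord xy.2 i.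

Definition gff_density (R : realType) (N : nat) (G : 'M[R[i]]_N)
    (z : 'I_N -> R[i]) : R[i] :=
  cexp (- \sum_(i < N) \sum_(j < N) Num.conj (z i) * invmx G i j * z j)
  / ((pi ^+ N)%:C * \det G).

(* Matrices and vectors indexed by V are indexed by 'I_#|V| along [enum_val]. *)
Definition weight_mx (R : realType) (V : finType) (q : V -> V -> R[i]) :
    'M[R[i]]_#|V| :=
  \matrix_(i, j) q (enum_val i) (enum_val j).

Definition spectral_radius (R : realType) (n : nat) (A : 'M[R[i]]_n) : R :=
  sup [set Normc.normc a | a in [set a : R[i] | eigenvalue A a]].

Definition integrable_weight (R : realType) (V : finType)
    (q : V -> V -> R[i]) : Prop :=
  spectral_radius (map_mx (fun z : R[i] => `|z|) (weight_mx q)) < 1.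

Definition hermitian_weight (R : realType) (V : finType)
    (q : V -> V -> R[i]) : Prop :=
  weight_mx q \is hermsymmx.

Definition green_mx (R : realType) (V : finType) (q : V -> V -> R[i]) :
    'M[R[i]]_#|V| :=
  invmx (1%:M - weight_mx q).

Section random_field.
Context d (Omega : measurableType d) (R : realType) (V : finType).
Context (Z : V -> Omega -> R[i]).

Definition reim_field (w : Omega) : realvec R #|V| * realvec R #|V| :=
  ([tuple complex.Re (Z (enum_val i) w) | i < #|V|],
   [tuple complex.Im (Z (enum_val i) w) | i < #|V|]).

(* The density is real-valued for a positive definite Hermitian G, so its real
   part is the density itself seen in R. *)
Definition is_gff (P : probability Omega R) (G : 'M[R[i]]_#|V|) : Prop :=
  measurable_fun [set: Omega] reim_field /\
  forall B, measurable B ->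
    pushforward P reim_field B =
    (\int[lebesgue_vec R #|V| \x lebesgue_vec R #|V|]_(xy in B)
       (complex.Re (gff_density G (cvec xy)))%:E)%E.

Definition sqnorm_field (w : Omega) : realvec R #|V| :=
  [tuple complex.Re (Num.conj (Z (enum_val i) w) * Z (enum_val i) w) | i < #|V|].

End random_field.

Section loops.
Context (V : finType).

(* The path (x_0, ..., x_k) is encoded as (x_0, [:: x_1; ...; x_k]). *)
Definition is_loop (w : V * seq V) : bool :=
  (w.2 != [::]) && (last w.1 w.2 == w.1).

Definition rooted_loop := {w : V * seq V | is_loop w}.

Definition loop_length (w : rooted_loop) : nat := size (val w).2.

Definition loop_time (u : V) (w : rooted_loop) : nat := count_mem u (val w).2.

(* (x_0, x_1, ..., x_k = x_0) |-> (x_1, ..., x_k, x_1) *)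
Definition cshift (w : V * seq V) : V * seq V := (head w.1 w.2, rot 1 w.2).

Definition loop_equiv (w w' : rooted_loop) : bool :=
  `[< exists k, val w' = iter k cshift (val w) >].

Lemma cshift_loop w : is_loop w -> is_loop (cshift w).
Proof.
case: w => x [//|y p]; rewrite /is_loop /cshift /= rot1_cons last_rcons.
by rewrite eqxx andbT -size_eq0 size_rcons.
Qed.

Lemma iter_shift_loop k w : is_loop w -> is_loop (iter k cshift w).
Proof. by move=> lw; elim: k => //= k /cshift_loop. Qed.

Lemma loop_eq w w' : is_loop w -> is_loop w' -> w.2 = w'.2 -> w = w'.
Proof.
by case: w w' => [x [//|y p]] [x' s] /andP[_ /eqP/= <-] /andP[_ /eqP/= <-] /= <-.
Qed.

Lemma iter_shift_rot k w : (k <= size w.2)%N -> (iter k cshift w).2 = rot k w.2.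
Proof.
elim: k => [|k IHk] ltk /=; first by rewrite rot0.
by rewrite IHk 1?ltnW// -rotS.
Qed.

Lemma iter_shift_size w k :
  is_loop w -> iter (k * size w.2)%N cshift w = w.
Proof.
move=> lw; elim: k => [//|k IHk]; rewrite mulSn iterD IHk.
by apply: loop_eq => //; [exact: iter_shift_loop|rewrite iter_shift_rot// rot_size].
Qed.

Lemma loop_equiv_is_equiv : equiv_class_of loop_equiv.
Proof.
split=> [w|w w'|w2 w1 w3].
- by apply/asboolP; exists 0%N.
- have sym w1 w2 : loop_equiv w1 w2 -> loop_equiv w2 w1.
    move=> /asboolP[k kE]; apply/asboolP.
    exists (k * size (val w1).2 - k)%N; rewrite kE -iterD subnK.
      by rewrite iter_shift_size//; exact: (valP w1).
    by rewrite leq_pmulr// lt0n size_eq0; have /andP[] := valP w1.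
  by apply/idP/idP; exact: sym.
- move=> /asboolP[k kE] /asboolP[l lE]; apply/asboolP.
  by exists (l + k)%N; rewrite iterD -kE.
Qed.

Canonical loop_equiv_rel := EquivRelPack loop_equiv_is_equiv.

Definition unrooted_loop := {eq_quot loop_equiv}%qT.

(* Independent of the representative, by [uloop_timeE]. *)
Definition uloop_time (u : V) (l : unrooted_loop) : nat := loop_time u (repr l).

Lemma uloop_timeE u (w : rooted_loop) :
  uloop_time u (\pi_unrooted_loop w)%qT = loop_time u w.
Proof.
rewrite /uloop_time; case: piP => w' /eqmodP/asboolP[k kE].
rewrite /loop_time kE; elim: k {kE} => //= k <-.
by apply/seq.permP; rewrite perm_rot.
Qed.

Definition configuration := {fsfun unrooted_loop -> nat with 0%N}.

Definition occupation (u : V) (s : configuration) : nat :=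
  (\sum_(l <- finsupp s) s l * uloop_time u l)%N.

End loops.

Section loop_soup.
Context (R : realType) (V : finType).
Context (q : V -> V -> R[i]).

Definition path_weight (w : V * seq V) : R[i] :=
  \prod_(e <- zip (w.1 :: w.2) w.2) q e.1 e.2.

Definition loop_measure (l : unrooted_loop V) : R[i] :=
  \sum_(w \in [set w : rooted_loop V | \pi_(unrooted_loop V)%qT w = l])
    (path_weight (val w) / (loop_length w)%:R).

Definition loop_soup (s : configuration V) : R[i] :=
  cexp (- csum loop_measure)
  * \prod_(l <- finsupp s) (loop_measure l ^+ s l / ((s l)`!)%:R).

Definition occupation_term (t : realvec R #|V|) (s : configuration V) : R[i] :=
  loop_soup s *
  (\prod_(v : V) (vcoord t (enum_rank v) ^+ occupation v s
                  * expR (- vcoord t (enum_rank v))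
                  / ((occupation v s)`!)%:R))%:C.

Definition occupation_density (t : realvec R #|V|) : R[i] :=
  csum (occupation_term t).

Definition orthant : set (realvec R #|V|) :=
  [set t | forall i, 0 <= vcoord t i].

Definition occupation_field (A : set (realvec R #|V|)) : R[i] :=
  cintegral (lebesgue_vec R #|V|) (A `&` orthant) occupation_density.

End loop_soup.

(* Main.v *)
(* On |z_v|^2 = t_v the Gaussian density is det(I - Q) e^(- \sum t) e^<z,Qz> / pi^N,
   and the law of |Z|^2 at t is its average over the phases of the z_v, times pi^N.
   Expanding e^<z,Qz>, the average keeps the monomials in which every vertex occurs
   equally often among the z and the conjugates of z, which leaves \sum_c D(c) t^c / c!,
   where D(c) is the coefficient of x^c in \prod_u (\sum_v q_uv x_v)^(c_u). The
   total weight B(c) of the multisets of loops with occupation c satisfies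
   c_u B(c) = \sum_l n_u(l) m(l) B(c - n(l)) (mark one visit to u). Rooting the loop at
   that visit turns this into a recursion over closed walks at u that D satisfies as
   well, so that B = D (MacMahon's master theorem), and the series above is the
   occupation density once e^(- m(L)) = det(I - Q), which follows from
   m(L) = \sum_k tr Q^k / k. Phases are averaged over p-th roots of unity with p
   prime: each is a rotation, which preserves Lebesgue measure on C^N, and the
   average is exact in degree < p, with a uniformly small remainder on bounded sets. *)

Require Import Defs.
From HB Require Import structures.
From mathcomp Require Import all_boot all_order all_algebra finmap.
From mathcomp Require Import spectral sesquilinear complex.
From mathcomp Require Import all_classical all_reals all_analysis.
From mathcomp Require Import measurable_realfun.
From mathcomp Require Import zify ring lra.

Set Implicit Arguments.
Unset Strict Implicit.
Unset Printing Implicit Defensive.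
Import Order.TTheory GRing.Theory Num.Theory.
Import numFieldNormedType.Exports.

Local Open Scope classical_set_scope.
Local Open Scope ring_scope.
Local Open Scope complex_scope.

(** * Words and MacMahon's master theorem *)

(** The loop soup is only a complex measure, so its density comes with no positivity to rely on.
    Absolute convergence is obtained by running the same identities with |q| in place of q: |Q| is
    again Hermitian, so integrability bounds tr |Q|^k geometrically, and phase averages bound the
    degree n part of the density by a multiple of S^n / n!, where S = \sum |q_uv| sqrt (t_u t_v).
    Hermitian symmetry makes <z,Qz> real; the averages are then means of positive exponentials, and
    positivity of the density is a consequence of the averaging. Finite averages over rotations
    stand in for an integral over angles, so that only the behaviour of Lebesgue measure under
    shears and scalings enters. Primality of p yields a primitive root at once, and p odd keeps -1
    out of the group of phases, the one rotation that a product of shears does not reach. The error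
    is small only where S is bounded, which is why the identity is established on subsets of a box
    [0,K]^N and extended by monotone convergence, where the positivity is used. *)

Section words.
Context (V : finType).
Implicit Types (c : {ffun V -> nat}) (u v : V) (a b p : seq V).

Fixpoint words n : seq (seq V) :=
  if n is n'.+1 then [seq v :: p | v <- enum V, p <- words n'] else [:: [::]].

Lemma mem_words n p : (p \in words n) = (size p == n).
Proof.
elim: n p => [|n IHn] p /=; first by rewrite inE size_eq0.
apply/allpairsP/idP => [[[v p'] /= [_ + ->]]|]; first by rewrite IHn.
by case: p => // v p szp; exists (v, p); rewrite mem_enum IHn.
Qed.

Lemma size_words n p : p \in words n -> size p = n.
Proof. by rewrite mem_words => /eqP. Qed.

Lemma uniq_words n : uniq (words n).
Proof.
elim: n => //= n IHn; apply: allpairs_uniq => //; first exact: enum_uniq.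
by move=> [v p] [v' p'] _ _ /= [-> ->].
Qed.

Lemma big_words_cons (S : nmodType) n (P : pred (seq V)) (f : seq V -> S) :
  \sum_(p <- words n.+1 | P p) f p =
  \sum_v \sum_(p <- words n | P (v :: p)) f (v :: p).
Proof.
rewrite big_mkcond /= big_allpairs_dep big_enum /=.
by apply: eq_bigr => v _; rewrite -big_mkcond.
Qed.

Lemma big_words_rot (S : nmodType) n k (f : seq V -> S) :
  \sum_(p <- words n) f (rot k p) = \sum_(p <- words n) f p.
Proof.
rewrite -(big_map (rot k) xpredT f); apply: perm_big.
apply: uniq_perm; rewrite ?map_inj_uniq ?uniq_words//; first exact: rot_inj.
move=> p; apply/mapP/idP => [[p' + ->]|]; first by rewrite !mem_words size_rot.
rewrite mem_words => /eqP szp; exists (rotr k p); last by rewrite rotrK.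
by rewrite mem_words size_rotr szp.
Qed.

Definition wcontent a : {ffun V -> nat} := [ffun v => count_mem v a].

Definition decr c v : {ffun V -> nat} := [ffun w => (c w - (w == v))%N].

Definition weight c : nat := (\sum_v c v)%N.

Lemma weight_wcontent a : weight (wcontent a) = size a.
Proof.
rewrite /weight; under eq_bigr do rewrite ffunE.
elim: a => [|x a IHa] /=; first by rewrite big1.
by rewrite big_split/= IHa (bigD1 x)//= eqxx big1// => v /negbTE; rewrite eq_sym => ->.
Qed.

Lemma weight_decr c v : (0 < c v)%N -> weight c = (weight (decr c v)).+1.
Proof.
move=> cv; rewrite /weight (bigD1 v)// [in RHS](bigD1 v)//= ffunE eqxx.
rewrite (eq_bigr (fun w => decr c v w)); first by rewrite -addSn subn1 prednK.
by move=> w /negbTE wv; rewrite ffunE wv subn0.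
Qed.

Lemma weight_eq0 c : weight c = 0%N -> c = wcontent [::].
Proof.
move=> /eqP; rewrite sum_nat_eq0 => /forallP c0; apply/ffunP => v.
by rewrite ffunE /=; apply/eqP; have := c0 v.
Qed.

Lemma decrC c v w : decr (decr c v) w = decr (decr c w) v.
Proof. by apply/ffunP => x; rewrite !ffunE subnAC. Qed.

Lemma wcontent_cons v a c :
  (wcontent (v :: a) == c) = (0 < c v)%N && (wcontent a == decr c v).
Proof.
apply/eqP/andP => [<-|[cv /eqP ca]].
  by rewrite ffunE /= eqxx; split=> //; apply/eqP/ffunP => w; rewrite !ffunE/= eq_sym; lia.
apply/ffunP => w; have := congr1 (fun f : {ffun V -> nat} => f w) ca.
by rewrite !ffunE /= => ->; have [->|] := eqVneq w v; rewrite ?subn0 ?eqxx//; lia.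
Qed.

Lemma wcontent_perm a b : wcontent a = wcontent b -> perm_eq a b.
Proof.
by move=> ab; apply/allP => x _ /=; move/ffunP/(_ x): ab; rewrite !ffunE => ->.
Qed.

Definition word c : seq V := flatten [seq nseq (c v) v | v <- enum V].

Lemma wcontent_word c : wcontent (word c) = c.
Proof.
apply/ffunP => w; rewrite ffunE /word count_flatten -map_comp sumnE big_map big_enum /=.
rewrite (bigD1 w)//= count_nseq /= eqxx mul1n big1 ?addn0// => v /negbTE vw.
by rewrite count_nseq /= vw.
Qed.

Definition cfact c : nat := (\prod_v (c v)`!)%N.

Lemma cfact_decr c v : (0 < c v)%N -> cfact c = (c v * cfact (decr c v))%N.
Proof.
move=> cv; rewrite /cfact (bigD1 v)// [in RHS](bigD1 v)//= ffunE eqxx mulnA subn1.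
rewrite -[in X in (X * _)%N](prednK cv) factS prednK//; congr muln.
by apply: eq_bigr => w /negbTE wv; rewrite ffunE wv subn0.
Qed.

(** Sort the words by their first letter v: removing it divides [cfact c] by c v, and these factors
    c v add up to n. *)
Lemma multinomial_words n c : weight c = n ->
  (cfact c * \sum_(a <- words n | wcontent a == c) 1 = n`!)%N.
Proof.
elim: n c => [|n IHn] c wc.
  by rewrite big_mkcond big_seq1 (weight_eq0 wc) eqxx muln1 /cfact big1// => v; rewrite ffunE.
rewrite big_mkcond /= big_allpairs_dep big_enum /= big_distrr /=.
rewrite factS -[in X in (X * _)%N]wc /weight big_distrl /=; apply: eq_bigr => v _.
have [cv|] := ltnP 0 (c v); last first.
  rewrite leqn0 => cv; rewrite (eqP cv) mul0n big1 ?muln0// => a _.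
  by rewrite wcontent_cons (eqP cv).
rewrite (cfact_decr cv) -mulnA -(IHn (decr c v)).
  congr (_ * (_ * _))%N; rewrite [RHS]big_mkcond; apply: eq_bigr => a _.
  by rewrite wcontent_cons cv.
by move: wc; rewrite (weight_decr cv) => -[].
Qed.

End words.

Section macmahon.
Context (K : comNzRingType) (V : finType) (q : V -> V -> K).
Implicit Types (c : {ffun V -> nat}) (u v : V) (a b p : seq V).

Definition pair_weight a b : K := \prod_(e <- zip a b) q e.1 e.2.

(* The coefficient of x^c in the product over the letters v of a of the linear
   forms \sum_w q v w x_w. *)
Definition lincoef a c : K :=
  \sum_(b <- words V (size a) | wcontent b == c) pair_weight a b.

Definition diagcoef c : K := lincoef (word c) c.

Lemma lincoef_cons x a c :
  lincoef (x :: a) c = \sum_(v | (0 < c v)%N) q x v * lincoef a (decr c v).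
Proof.
rewrite /lincoef big_words_cons [RHS]big_mkcond; apply: eq_bigr => v _.
case: ifP => cv; last by rewrite big1// => p; rewrite wcontent_cons cv.
rewrite big_distrr; apply: eq_big => [p|p _] /=; first by rewrite wcontent_cons cv.
by rewrite /pair_weight /= big_cons.
Qed.

(** Commutativity of the product of two linear forms, read on coefficients: exchanging the first two
    letters of a is matched by exchanging the first two letters of b. *)
Lemma lincoef_swap x y a c : lincoef (x :: y :: a) c = lincoef (y :: x :: a) c.
Proof.
rewrite !lincoef_cons.
under eq_bigr do rewrite lincoef_cons big_distrr /=.
under [RHS]eq_bigr do rewrite lincoef_cons big_distrr /=.
rewrite (exchange_big_dep (fun w => 0 < c w)%N) /=; last first.
  by move=> v w _; rewrite ffunE; lia.
apply: eq_bigr => v cv; rewrite [RHS]big_mkcond [LHS]big_mkcond; apply: eq_bigr => w _.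
rewrite !ffunE decrC mulrCA [(w == v)]eq_sym; have [->|vw] := eqVneq v w.
  by case: ifP; case: ifP => //; lia.
by rewrite !subn0 cv andbT.
Qed.

Lemma lincoef_perm a b c : perm_eq a b -> lincoef a c = lincoef b c.
Proof.
have shift x s r c' : lincoef (s ++ x :: r) c' = lincoef (x :: s ++ r) c'.
  elim: s c' => //= y s IHs c'; rewrite lincoef_swap [LHS]lincoef_cons [RHS]lincoef_cons.
  by apply: eq_bigr => v _; rewrite IHs.
elim: a b c => [|x a IHa] b c ab; first by move/perm_size/esym/eqP: (ab); rewrite size_eq0 => /eqP ->.
have xb : x \in b by rewrite -(perm_mem ab) mem_head.
case/splitPr: xb ab => s r ab; rewrite shift [LHS]lincoef_cons [RHS]lincoef_cons.
apply: eq_bigr => v _; congr (_ * _); apply: IHa.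
by rewrite -(perm_cons x) (perm_trans ab)// (perm_catCA s [:: x] r).
Qed.

Lemma lincoef_diag a : lincoef a (wcontent a) = diagcoef (wcontent a).
Proof. by apply: lincoef_perm; apply: wcontent_perm; rewrite wcontent_word. Qed.

Section walks.
Variables (u : V) (G : {ffun V -> nat} -> K).

Definition leqc c c' := [forall v, c v <= c' v]%N.
Definition subc c c' : {ffun V -> nat} := [ffun v => c v - c' v]%N.

Definition walk_sum k w c : K :=
  \sum_(p <- words V k | (last w p == u) && leqc (wcontent p) c)
     pair_weight (w :: p) p * G (subc c (wcontent p)).

Lemma walk_sum0 w c : walk_sum 0 w c = (w == u)%:R * G c.
Proof.
rewrite /walk_sum big_mkcond big_seq1 /=.
have -> : leqc (wcontent [::]) c by apply/forallP => v; rewrite ffunE.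
rewrite andbT; case: eqP => _; last by rewrite mul0r.
rewrite /pair_weight big_nil; congr (_ * G _).
by apply/ffunP => v; rewrite !ffunE subn0.
Qed.

Lemma walk_sumS k w c : walk_sum k.+1 w c =
  \sum_(v | (0 < c v)%N) q w v * walk_sum k v (decr c v).
Proof.
have leqE v p : leqc (wcontent (v :: p)) c = (0 < c v)%N && leqc (wcontent p) (decr c v).
  apply/forallP/andP => [h|[cv /forallP h] x].
    split; first by have := h v; rewrite ffunE /= eqxx; lia.
    by apply/forallP => x; have := h x; rewrite !ffunE /= eq_sym; lia.
  have := h x; rewrite !ffunE /= [x == v]eq_sym; have [<-|] := eqVneq v x; lia.
rewrite /walk_sum big_words_cons [RHS]big_mkcond; apply: eq_bigr => v _.
case: ifP => cv; last by rewrite big1// => p; rewrite leqE cv andbF.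
rewrite big_distrr; apply: eq_big => [p|p _] /=; first by rewrite leqE cv.
rewrite /pair_weight /= big_cons /= -mulrA; congr (_ * (_ * G _)).
by apply/ffunP => x; rewrite !ffunE /= eq_sym subnDA.
Qed.

End walks.

(** Induction on the first step w -> v. Followed by the letters still to be used, v rearranges
    [word (decr c u)], so both sides carry the same coefficient. The walk may stop at v only if v =
    u, and this contributes the unit that [decr c v] has removed from c u. At w = u the right-hand
    side is c u times [diagcoef c]. *)
Lemma walk_sum_diag u n w c : weight c = n ->
  \sum_(1 <= k < n.+1) walk_sum u diagcoef k w c =
  (c u)%:R * lincoef (w :: word (decr c u)) c.
Proof.
elim: n w c => [|n IHn] w c wc.
  by rewrite big_geq// (weight_eq0 wc) ffunE mul0r.
rewrite big_add1 /=; under eq_bigr do rewrite walk_sumS.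
rewrite exchange_big /= lincoef_cons big_distrr /=; apply: eq_bigr => v cv.
rewrite -big_distrr /= mulrCA; congr (_ * _).
have wcv : weight (decr c v) = n by move: wc; rewrite (weight_decr cv) => -[].
(* Length 0 closes the walk at v itself; the longer walks from v fall under the induction
   hypothesis. *)
rewrite big_nat_recl//= -(big_add1 _ _ 0 n.+1 xpredT (fun k => walk_sum u diagcoef k v (decr c v))).
rewrite IHn// walk_sum0 ffunE.
have permD : (0 < decr c v u)%N -> lincoef (v :: word (decr (decr c v) u)) (decr c v) =
    lincoef (word (decr c u)) (decr c v).
  rewrite ffunE => cvu; apply: lincoef_perm; apply: wcontent_perm.
  apply/eqP; rewrite wcontent_word wcontent_cons wcontent_word decrC eqxx andbT ffunE.
  by move: cvu cv; rewrite [v == u]eq_sym; have [->|] := eqVneq u v; lia.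
move: permD cv; rewrite ffunE eq_sym; have [->|vu] := eqVneq v u => permD cv.
  (* For c u = 1 no further visit to u is left: [permD] does not apply, but its term has the factor
     c u - 1 = 0. *)
  rewrite /diagcoef mul1r; have [->|c1] := eqVneq (c u) 1%N.
    by rewrite subnn mul0r addr0 mul1r.
  have cu1 : (c u)%:R = 1 + (c u - 1)%:R :> K.
    by rewrite -[1]/(1%:R) -natrD; congr (_%:R); lia.
  by rewrite cu1 mulrDl mul1r permD//; lia.
rewrite mul0r add0r subn0 in permD *.
by case: (posnP (c u)) permD => [->|cu ->//]; rewrite !mul0r.
Qed.

(** A walk of k steps uses up k units of content, so G is only evaluated at weight at most
    [weight c - k]. For k > 0 the recursion therefore determines its solution by induction on the
    weight. *)
Lemma eq_walk_sum u (G G' : {ffun V -> nat} -> K) k w c :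
  (forall c', (weight c' <= weight c - k)%N -> G c' = G' c') ->
  walk_sum u G k w c = walk_sum u G' k w c.
Proof.
elim: k w c => [|k IHk] w c GG'; first by rewrite !walk_sum0 GG'// subn0.
rewrite !walk_sumS; apply: eq_bigr => v cv; rewrite IHk// => c' lec'.
by apply: GG'; rewrite (weight_decr cv); lia.
Qed.

End macmahon.

(* Since [diagcoef] satisfies the recursion by [walk_sum_diag], this is MacMahon's
   master theorem in the form 1 / det(1 - XQ) = \sum_c diagcoef c x^c. *)
Lemma diagcoef_unique (K : numFieldType) (V : finType) (q : V -> V -> K)
    (B : {ffun V -> nat} -> K) :
  B (wcontent [::]) = 1 ->
  (forall u (c : {ffun V -> nat}), (0 < c u)%N ->
     (c u)%:R * B c = \sum_(1 <= k < (weight c).+1) walk_sum q u B k u c) ->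
  forall c, B c = diagcoef q c.
Proof.
move=> B0 Brec c; have [n] := ubnP (weight c).
elim: n c => // n IHn c wc.
have [c0|c0] := eqVneq (weight c) 0%N.
  rewrite (weight_eq0 c0) B0 -lincoef_diag /lincoef /= big_mkcond big_seq1 eqxx.
  by rewrite /pair_weight big_nil.
have := c0; rewrite {1}/weight sum_nat_eq0 negb_forall => /existsP[u]; rewrite implyTb -lt0n => cu.
apply: (@mulfI _ (c u)%:R); first by rewrite pnatr_eq0 -lt0n.
rewrite Brec// (eq_big_nat _ _ (F2 := fun k => walk_sum q u (diagcoef q) k u c)).
  rewrite walk_sum_diag//; congr (_ * _); rewrite /diagcoef.
  apply: lincoef_perm; apply: wcontent_perm; apply/eqP.
  by rewrite wcontent_word wcontent_cons wcontent_word cu eqxx.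
by move=> k /andP[k0 _]; apply: eq_walk_sum => c' c'c; apply: IHn; lia.
Qed.

(** * Averages of powers of a sesquilinear form over roots of unity *)

Section phase_average.
Context (K : numFieldType) (V : finType) (q : V -> V -> K).
Implicit Types (x y : V -> K).

Definition sesq x y : K := \sum_u \sum_v x u * q u v * y v.

Lemma sesq_expn n x y : sesq x y ^+ n =
  \sum_(a <- words V n) \sum_(b <- words V n)
     pair_weight q a b * (\prod_(u <- a) x u) * (\prod_(v <- b) y v).
Proof.
elim: n => [|n IHn]; first by rewrite !big_seq1 /pair_weight /= !big_nil !mulr1.
rewrite exprS IHn big_words_cons /sesq mulr_suml; apply: eq_bigr => u _.
rewrite mulr_suml [RHS](eq_bigr (fun a => \sum_v \sum_(b <- words V n)
  pair_weight q (u :: a) (v :: b) * (\prod_(w <- u :: a) x w) * (\prod_(w <- v :: b) y w))).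
  rewrite [RHS]exchange_big; apply: eq_bigr => v _.
  rewrite mulr_sumr; apply: eq_bigr => a _.
  rewrite mulr_sumr; apply: eq_bigr => b _.
  by rewrite /pair_weight /= !big_cons /=; ring.
by move=> a _; rewrite big_words_cons.
Qed.

Lemma prod_content (f : V -> K) (a : seq V) :
  \prod_(u <- a) f u = \prod_v f v ^+ wcontent a v.
Proof.
elim: a => [|u a IHa]; first by rewrite big_nil big1// => v _; rewrite ffunE.
rewrite big_cons IHa [RHS](bigD1 u)// [in LHS](bigD1 u)//= !ffunE /= eqxx exprS mulrA.
by congr (_ * _); apply: eq_bigr => v /negbTE; rewrite !ffunE /= eq_sym => ->.
Qed.

Variables (M : nat) (om : K).
Hypotheses (omP : M.-primitive_root om).

Lemma sum_unity_root k l : (k < M)%N -> (l < M)%N ->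
  \sum_(j < M) om ^- (j * k) * om ^+ (j * l) = M%:R * (k == l)%:R.
Proof.
move=> kM lM; have om0 : om != 0.
  apply/eqP => om0; have := prim_expr_order omP; rewrite om0 expr0n.
  by rewrite (gtn_eqF (leq_ltn_trans _ kM))// => /eqP; rewrite eq_sym oner_eq0.
under eq_bigr do rewrite !(mulnC (nat_of_ord _)) !exprM -exprVn -exprMn.
have [<-|kl] := eqVneq k l.
  rewrite mulr1 (eq_bigr (fun=> 1)) ?sumr_const ?card_ord// => j _.
  by rewrite mulVf ?expr1n// expf_neq0.
rewrite mulr0; set z := _ * _.
have zM : z ^+ M - 1 = 0.
  have omX i : (om ^+ i) ^+ M = 1 by rewrite exprAC (prim_expr_order omP) expr1n.
  by rewrite /z exprMn exprVn !omX invr1 mulr1 subrr.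
have z1 : z != 1.
  apply: contra kl => /eqP z1; have := eq_prim_root_expr omP k l; rewrite !modn_small// => <-.
  by rewrite eq_sym; apply/eqP/(mulfI (invr_neq0 (expf_neq0 k om0))); rewrite -/z z1 mulVf// expf_neq0.
by move: zM; rewrite subrX1 => /eqP; rewrite mulf_eq0 subr_eq0 (negbTE z1) => /eqP.
Qed.

(** The phases at different vertices are independent, so the average of each monomial factors into
    one geometric sum per vertex. Words of length n < M have contents below M, where congruence
    modulo M is equality; hence only pairs a, b with equal content survive, and such b are
    rearrangements of a. *)
Lemma phase_average n x y : (n < M)%N ->
  \sum_(j : {ffun V -> 'I_M})
     sesq (fun u => x u * om ^- j u) (fun v => y v * om ^+ j v) ^+ n =
  (M ^ #|V|)%:R *
    \sum_(a <- words V n) lincoef q a (wcontent a) * \prod_(u <- a) (x u * y u).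
Proof.
move=> nM; under eq_bigr do rewrite sesq_expn.
rewrite exchange_big mulr_sumr /= [LHS]big_seq [RHS]big_seq; apply: eq_bigr => a aw.
rewrite exchange_big /lincoef /= mulrCA mulr_suml (size_words aw) [RHS]big_mkcond.
rewrite [LHS]big_seq [RHS]big_seq; apply: eq_bigr => b bw.
have cM (c : seq V) v : c \in words V n -> (wcontent c v < M)%N.
  by move=> /size_words cn; rewrite ffunE (leq_ltn_trans (count_size _ _))// cn.
under eq_bigr do rewrite !big_split /=.
transitivity (pair_weight q a b * \prod_(u <- a) x u * \prod_(v <- b) y v *
    \sum_(j : {ffun V -> 'I_M}) \prod_v (om ^- (j v * wcontent a v) * om ^+ (j v * wcontent b v))).
  rewrite mulr_sumr; apply: eq_bigr => j _.
  rewrite (prod_content (fun u => om ^- j u)) (prod_content (fun v => om ^+ j v)).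
  under [X in _ = _ * X]eq_bigr do rewrite !exprM -exprVn.
  rewrite big_split /= -!mulrA; do 2?congr (_ * _).
  rewrite [LHS]mulrCA; congr (_ * _); congr (_ * _); congr (_ * _).
rewrite -(bigA_distr_bigA (fun v (j : 'I_M) => om ^- (j * wcontent a v) * om ^+ (j * wcontent b v))).
under [X in _ * X = _]eq_bigr do rewrite sum_unity_root ?cM//.
rewrite big_split /= prodr_const -natrX; case: eqP => [ba|ba]; last first.
  have /existsP[v vP] : [exists v, wcontent a v != wcontent b v].
    apply/contra_notT: ba; rewrite negb_exists => /forallP h; apply/ffunP => v.
    by have := h v; rewrite negbK => /eqP.
  by rewrite [X in _ * (_ * X) = _](bigD1 v)//= (negbTE vP) mul0r !mulr0.
have -> : \prod_i (wcontent a i == wcontent b i)%:R = 1 :> K.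
  by apply: big1 => v _; rewrite ba eqxx.
by rewrite big_split /= (perm_big _ (wcontent_perm ba)) /=; ring.
Qed.

End phase_average.

(** * Rotations of closed words *)

Section closed_words.
Context (K : numFieldType) (V : finType) (q : V -> V -> K).
Implicit Types (u v : V) (p : seq V).

Lemma pair_weight_rcons u v p :
  pair_weight q (u :: rcons p v) (rcons p v) =
  pair_weight q (u :: p) p * q (last u p) v.
Proof.
elim: p u => [|x p IHp] u; rewrite /pair_weight /= !big_cons ?big_nil ?mul1r ?mulr1//=.
by have := IHp x; rewrite /pair_weight => ->; rewrite mulrA.
Qed.

(** The base vertex of a closed nonempty word is its last letter, so the word alone determines the
    base after rotation. One rotation step moves the first factor of the weight to the end. *)
Lemma pair_weight_rot u v j p : last u p = u -> last v (rot j p) = v ->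
  pair_weight q (v :: rot j p) (rot j p) = pair_weight q (u :: p) p.
Proof.
have rot1W u' v' p' : last u' p' = u' -> last v' (rot 1 p') = v' ->
    pair_weight q (v' :: rot 1 p') (rot 1 p') = pair_weight q (u' :: p') p'.
  case: p' => [|x p']; first by rewrite /pair_weight /= !big_nil.
  rewrite rot1_cons last_rcons => /= lu <-; rewrite pair_weight_rcons lu.
  by rewrite /pair_weight [in RHS]/= big_cons /= mulrC.
have lastr (w w' : V) s : s != [::] -> last w s = last w' s by case: s.
have [->|p0] := eqVneq p [::]; first by rewrite /pair_weight /= !big_nil.
have [jp|pj] := leqP j (size p); last first.
  by rewrite rot_oversize 1?ltnW// => lu lv; suff -> : u = v by []; rewrite -lu (lastr _ v).
elim: j v jp => [|j IHj] v jp lu; first by rewrite rot0 => lv; suff -> : u = v by []; rewrite -lu (lastr _ v).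
rewrite -add1n rotD// => lv.
have r0 : rot j p != [::] by rewrite -size_eq0 size_rot size_eq0.
pose w := last u (rot j p).
have lw : last w (rot j p) = w by rewrite /w (lastr _ u).
by rewrite (rot1W w)// (IHj w)// ltnW.
Qed.

(** Letter j of p ends the rotation by j + 1: the visits to u are exactly the rotations based at
    u. *)
Lemma count_last_rot u p :
  count_mem u p = (\sum_(j < size p) (last u (rot j.+1 p) == u))%N.
Proof.
rewrite -sum1_count (big_nth u) big_mkord big_mkcond; apply: eq_bigr => j _.
by rewrite /rot last_cat (take_nth u (ltn_ord j)) last_rcons /=; case: (_ == _).
Qed.

(* Every cyclic rotation of a closed word contributes equally, so that rooting
   at u costs the factor (visits to u) / length. *)
Lemma sum_closed_words u k (H : {ffun V -> nat} -> K) : (0 < k)%N ->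
  \sum_v \sum_(p <- words V k | last v p == v)
     (wcontent p u)%:R * (pair_weight q (v :: p) p / k%:R * H (wcontent p)) =
  \sum_(p <- words V k | last u p == u) pair_weight q (u :: p) p * H (wcontent p).
Proof.
move=> k0.
have lastr (w w' : V) s : (0 < size s)%N -> last w s = last w' s by case: s.
pose phi p := pair_weight q (last u p :: p) p * H (wcontent p).
have phi_rot j p : (0 < size p)%N -> phi (rot j p) = phi p.
  move=> p0; rewrite /phi; congr (_ * H _); last first.
    by apply/ffunP => x; rewrite !ffunE; apply/seq.permP; rewrite perm_rot.
  by rewrite (@pair_weight_rot (last u p))//; apply: lastr; rewrite ?size_rot.
transitivity (\sum_(p <- words V k) (wcontent p u)%:R / k%:R * phi p).
  under eq_bigr do rewrite big_mkcond /=.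
  rewrite exchange_big /= [LHS]big_seq [RHS]big_seq; apply: eq_bigr => p /size_words szp.
  rewrite (bigD1 (last u p))//= big1 ?addr0; last first.
    by move=> v vp; rewrite (lastr _ u) ?szp// eq_sym (negbTE vp).
  by rewrite (lastr _ u) ?szp// eqxx /phi; ring.
transitivity (k%:R^-1 * \sum_(p <- words V k) \sum_(j < k)
    (last u (rot j.+1 p) == u)%:R * phi (rot j.+1 p)).
  rewrite mulr_sumr [LHS]big_seq [RHS]big_seq; apply: eq_bigr => p /size_words szp.
  rewrite ffunE count_last_rot natr_sum szp [_ / _]mulrC -mulrA; congr (_ * _).
  by rewrite mulr_suml; apply: eq_bigr => j _; rewrite phi_rot// szp.
rewrite exchange_big /=.
under eq_bigr => j _ do rewrite (big_words_rot k j.+1 (fun p => (last u p == u)%:R * phi p)).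
rewrite sumr_const card_ord -[X in _ * X = _]mulr_natl mulKf ?pnatr_eq0 -?lt0n// [RHS]big_mkcond.
by apply: eq_bigr => p _; rewrite /phi; case: eqP => [->|]; rewrite ?mul1r ?mul0r.
Qed.

End closed_words.

(** * The loop soup by total length *)

Section loop_enumeration.
Context (V : finType).
Implicit Types (l : unrooted_loop V) (w : rooted_loop V).

Definition rloops k : seq (rooted_loop V) :=
  pmap insub [seq (u, p) | u <- enum V, p <- words V k].

Lemma mem_rloops k w : (w \in rloops k) = (loop_length w == k).
Proof.
rewrite mem_pmap_sub /loop_length; case: w => -[u p] /= wl.
apply/allpairsP/eqP => [[[v p'] /= [_ p'w [_ ->]]]|pk]; first exact: size_words p'w.
by exists (u, p); rewrite mem_enum mem_words pk.
Qed.

Lemma uniq_rloops k : uniq (rloops k).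
Proof.
apply: pmap_sub_uniq; apply: allpairs_uniq; rewrite ?enum_uniq ?uniq_words//.
by move=> [u p] [v p'].
Qed.

Lemma big_rloops (S : nmodType) k (f : V * seq V -> S) : (0 < k)%N ->
  \sum_(w <- rloops k) f (val w) =
  \sum_u \sum_(p <- words V k | last u p == u) f (u, p).
Proof.
move=> k0; rewrite -(big_map val xpredT f) /rloops.
rewrite (pmap_filter (insubK _)) (eq_filter (@isSome_insub _ _ _)) big_filter big_mkcond.
rewrite big_allpairs_dep big_enum; apply: eq_bigr => u _ /=.
rewrite [RHS]big_mkcond [LHS]big_seq [RHS]big_seq; apply: eq_bigr => p /size_words pk.
by rewrite /is_loop /= -size_eq0 pk -lt0n k0.
Qed.

Definition uloop_length l : nat := loop_length (repr l).

Lemma uloop_lengthE w : uloop_length (\pi_(unrooted_loop V)%qT w) = loop_length w.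
Proof.
rewrite /uloop_length; case: piP => w' /eqmodP/asboolP[k kE].
rewrite /loop_length kE; elim: k {kE} => //= k <-.
by rewrite size_rot.
Qed.

Lemma uloop_length_gt0 l : (0 < uloop_length l)%N.
Proof.
by rewrite /uloop_length /loop_length lt0n size_eq0; case/andP: (valP (repr l)).
Qed.

Definition uloop_content l : {ffun V -> nat} := [ffun u => uloop_time u l].

Lemma uloop_contentE w :
  uloop_content (\pi_(unrooted_loop V)%qT w) = wcontent (val w).2.
Proof. by apply/ffunP => u; rewrite !ffunE uloop_timeE. Qed.

Lemma weight_uloop l : weight (uloop_content l) = uloop_length l.
Proof.
by rewrite -[l]reprK uloop_contentE weight_wcontent uloop_lengthE.
Qed.

Definition uloops k : seq (unrooted_loop V) :=
  undup [seq \pi_(unrooted_loop V)%qT w | w <- rloops k].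

Lemma mem_uloops k l : (l \in uloops k) = (uloop_length l == k).
Proof.
rewrite mem_undup; apply/mapP/eqP => [[w + ->]|lk].
  by rewrite mem_rloops uloop_lengthE => /eqP.
by exists (repr l); rewrite ?reprK// mem_rloops -lk.
Qed.

End loop_enumeration.

Section loop_measure.
Context (R : realType) (V : finType) (q : V -> V -> R[i]).

Lemma path_weightE w : path_weight q w = pair_weight q (w.1 :: w.2) w.2.
Proof. by []. Qed.

(** The sum in [loop_measure] ranges over a set and takes a default value unless its support is
    finite. All representatives of l have the same length, so they form a finite list and the sum is
    the intended one. *)
Lemma loop_measureE k (l : unrooted_loop V) : uloop_length l = k ->
  loop_measure q l =
  \sum_(w <- rloops V k | \pi_(unrooted_loop V)%qT w == l)
     path_weight q (val w) / k%:R.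
Proof.
move=> lk; rewrite -big_filter fsbig_seq ?filter_uniq ?uniq_rloops//.
rewrite /loop_measure (_ : [set w | _] = [set` [seq w <- rloops V k | \pi_(unrooted_loop V)%qT w == l]]).
  apply: eq_fsbigr => w; rewrite inE /= mem_filter mem_rloops => /andP[_ /eqP ->].
  by [].
apply/seteqP; split=> w /=; rewrite mem_filter mem_rloops; last by case/andP => /eqP.
by move=> wl; rewrite wl eqxx -lk -wl uloop_lengthE eqxx.
Qed.

Lemma big_uloops (S : pzSemiRingType) k (f : unrooted_loop V -> S) (g : rooted_loop V -> S) :
  \sum_(l <- uloops V k) f l *
    (\sum_(w <- rloops V k | \pi_(unrooted_loop V)%qT w == l) g w) =
  \sum_(w <- rloops V k) f (\pi_(unrooted_loop V)%qT w) * g w.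
Proof.
under eq_bigr do rewrite big_distrr big_mkcond /=.
rewrite exchange_big /= [LHS]big_seq [RHS]big_seq; apply: eq_bigr => w wk.
have wu : \pi_(unrooted_loop V)%qT w \in uloops V k.
  by rewrite mem_uloops uloop_lengthE -mem_rloops.
rewrite (bigD1_seq (\pi_(unrooted_loop V)%qT w))//= ?undup_uniq// eqxx big1 ?addr0//.
by move=> l /negbTE; rewrite eq_sym => ->.
Qed.

Lemma sum_loop_measure u k (H : {ffun V -> nat} -> R[i]) : (0 < k)%N ->
  \sum_(l <- uloops V k) (uloop_time u l)%:R * loop_measure q l * H (uloop_content l) =
  \sum_(p <- words V k | last u p == u) pair_weight q (u :: p) p * H (wcontent p).
Proof.
move=> k0; rewrite -sum_closed_words//.
transitivity (\sum_(w <- rloops V k) (wcontent (val w).2 u)%:R *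
  (path_weight q (val w) / k%:R * H (wcontent (val w).2))).
  under [RHS]eq_bigr do rewrite mulrCA -uloop_contentE mulrC.
  rewrite -(big_uloops k (fun l => (uloop_content l u)%:R * H (uloop_content l))).
  rewrite [LHS]big_seq [RHS]big_seq; apply: eq_bigr => l.
  rewrite mem_uloops => /eqP lk; rewrite (loop_measureE lk) ffunE.
  by rewrite mulrAC.
by rewrite (big_rloops (fun w => (wcontent w.2 u)%:R * (path_weight q w / k%:R * H (wcontent w.2)))).
Qed.

End loop_measure.

(** * Finite multisets of loops, graded by total length *)

Section configurations.
Context (V : finType).
Implicit Types (l : unrooted_loop V) (s : configuration V).

Definition occ s : {ffun V -> nat} := [ffun v => occupation v s].

Definition addl l s : configuration V := [fsfun s with l |-> (s l).+1].

Definition subl l s : configuration V := [fsfun s with l |-> (s l).-1].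

Lemma addlE l s x : addl l s x = (s x + (x == l))%N.
Proof. by rewrite fsfun_withE; case: eqP => [->|]; rewrite ?addn1 ?addn0. Qed.

Lemma addl_inj l : injective (addl l).
Proof.
move=> s s' /fsfunP ss'; apply/fsfunP => x; have := ss' x.
by rewrite !addlE => /addIn.
Qed.

Lemma sublK l s : (0 < s l)%N -> addl l (subl l s) = s.
Proof.
move=> sl; apply/fsfunP => x; rewrite addlE fsfun_withE.
by case: eqP => [->|]; rewrite ?addn0 ?addn1 ?prednK.
Qed.

(** A common index set A allows s and [addl l s] to be compared term by term although their supports
    may differ. *)
Lemma occupation_widen (A : {fset unrooted_loop V}) v s : (finsupp s `<=` A)%fset ->
  occupation v s = (\sum_(l <- A) s l * uloop_time v l)%N.
Proof.
by move=> sA; apply: big_fset_incl => // x _ xs; rewrite fsfun_dflt.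
Qed.

Lemma occ_addl l s v : occ (addl l s) v = (occ s v + uloop_content l v)%N.
Proof.
rewrite !ffunE; pose A := (l |` finsupp s)%fset.
have sA : (finsupp s `<=` A)%fset by apply: fsubsetU1.
have saA : (finsupp (addl l s) `<=` A)%fset by rewrite finsupp_with.
have lA : l \in A by rewrite !inE eqxx.
rewrite (occupation_widen _ saA) (occupation_widen _ sA).
rewrite !(big_fsetD1 _ lA) /= addlE eqxx mulnDl mul1n addnAC; congr (_ + _ + _)%N.
rewrite !big_seq; apply: eq_bigr => x; rewrite !inE => /andP[/negbTE xl _].
by rewrite addlE xl addn0.
Qed.

Lemma weight_occ_addl l s :
  weight (occ (addl l s)) = (weight (occ s) + uloop_length l)%N.
Proof.
rewrite -weight_uloop /weight -big_split; apply: eq_bigr => v _.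
by rewrite occ_addl.
Qed.

Lemma occ_neq0 s l : (0 < s l)%N -> (uloop_length l <= weight (occ s))%N.
Proof. by move=> sl; rewrite -(sublK sl) weight_occ_addl leq_addl. Qed.

Definition conf0 : configuration V := [fsfun].

Lemma weight_occ_eq0 s : weight (occ s) = 0%N -> s = conf0.
Proof.
move=> s0; apply/fsfunP => l; rewrite fsfun0E; apply/eqP/negPn; rewrite -lt0n.
apply/negP => /occ_neq0; rewrite s0 leqn0 => /eqP l0.
by have := uloop_length_gt0 l; rewrite l0.
Qed.

Lemma occ_conf0 : occ conf0 = wcontent [::].
Proof. by apply/ffunP => v; rewrite !ffunE /occupation finsupp0 big_seq_fset0. Qed.

(** A configuration of total length n > 0 contains a loop of some length k + 1 with k < n, and
    removing it leaves total length n - (k + 1). Level n is thus covered by finitely many images of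
    lower levels; level 0 holds only the empty configuration because loops have positive length. *)
Lemma finite_level n : finite_set [set s | weight (occ s) = n].
Proof.
have [m] := ubnP n; elim: m n => // m IHm n nm.
have [->|n0] := eqVneq n 0%N.
  by apply: (@sub_finite_set _ _ [set conf0]) => // s /=; exact: weight_occ_eq0.
apply: (@sub_finite_set _ _ (\bigcup_(k in `I_n) \bigcup_(l in [set` uloops V k.+1])
   (addl l @` [set s | weight (occ s) = (n - k.+1)%N]))); last first.
  apply: bigcup_finite => // k kn; apply: bigcup_finite => // l _.
  by apply/finite_image/IHm; lia.
move=> s /= sn.
have [l sl] : exists l, (0 < s l)%N.
  apply: contrapT => h; suff /eqP : weight (occ s) = 0%N by rewrite sn (negbTE n0).
  suff -> : s = conf0 by rewrite occ_conf0 weight_wcontent.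
  apply/fsfunP => l; rewrite fsfun0E; apply/eqP; rewrite -leqn0 leqNgt.
  by apply/negP => sl; apply: h; exists l.
have ls := occ_neq0 sl; have l0 := uloop_length_gt0 l.
exists (uloop_length l).-1; first by rewrite /=; lia.
exists l; first by rewrite /= mem_uloops prednK.
exists (subl l s); last exact: sublK.
by have := weight_occ_addl l (subl l s); rewrite /= sublK// prednK//; lia.
Qed.

Definition level n : seq (configuration V) := fset_set [set s | weight (occ s) = n].

Lemma mem_level n s : (s \in level n) = (weight (occ s) == n).
Proof.
rewrite /level in_fset_set; last exact: finite_level.
by apply/idP/eqP; rewrite inE.
Qed.

Lemma uniq_level n : uniq (level n).
Proof. exact: fset_uniq. Qed.

End configurations.

Section configuration_weight.
Context (K : numFieldType) (V : finType) (m : unrooted_loop V -> K).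
Implicit Types (l : unrooted_loop V) (s : configuration V) (c : {ffun V -> nat}).

Definition conf_weight s : K := \prod_(l <- finsupp s) (m l ^+ s l / ((s l)`!)%:R).

Lemma conf_weight_widen (A : {fset unrooted_loop V}) s : (finsupp s `<=` A)%fset ->
  conf_weight s = \prod_(l <- A) (m l ^+ s l / ((s l)`!)%:R).
Proof.
move=> sA; apply: big_fset_incl => // x _ xs.
by rewrite fsfun_dflt// expr0 fact0 divr1.
Qed.

Lemma conf_weight_addl l s :
  (addl l s l)%:R * conf_weight (addl l s) = m l * conf_weight s.
Proof.
pose A := (l |` finsupp s)%fset.
have sA : (finsupp s `<=` A)%fset by apply: fsubsetU1.
have saA : (finsupp (addl l s) `<=` A)%fset by rewrite finsupp_with.
have lA : l \in A by rewrite !inE eqxx.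
rewrite (conf_weight_widen saA) (conf_weight_widen sA) !(big_fsetD1 _ lA) /= !mulrA.
congr (_ * _); last first.
  rewrite [LHS]big_seq [RHS]big_seq; apply: eq_bigr => x; rewrite !inE => /andP[/negbTE xl _].
  by rewrite addlE xl addn0.
rewrite addlE eqxx addn1 factS natrM exprS.
have s0 : (s l).+1%:R != 0 :> K by rewrite pnatr_eq0.
have f0 : (s l)`!%:R != 0 :> K by rewrite pnatr_eq0 -lt0n fact_gt0.
move: ((s l).+1%:R : K) ((s l)`!%:R : K) (m l ^+ s l) s0 f0 => a b e a0 b0.
by field; rewrite a0 b0.
Qed.

Lemma conf_weight0 : conf_weight (conf0 V) = 1.
Proof. by rewrite /conf_weight finsupp0 big_seq_fset0. Qed.

(** The total weight B(c). The content determines the total length, so restricting to one level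
    makes the sum finite and loses no configuration. *)
Definition occ_weight c : K :=
  \sum_(s <- level V (weight c) | occ s == c) conf_weight s.

Lemma occ_weight0 : occ_weight (wcontent [::]) = 1.
Proof.
rewrite /occ_weight big_mkcond (bigD1_seq (conf0 V)) ?uniq_level//=; last first.
  by rewrite mem_level occ_conf0.
rewrite occ_conf0 eqxx conf_weight0 big1 ?addr0// => s s0.
case: eqP => // so; case/eqP: s0; apply: weight_occ_eq0.
by rewrite so weight_wcontent.
Qed.

(** Marking one copy of l and removing it is a bijection onto the configurations of content c -
    n(l); by [conf_weight_addl] the multiplicity s l is traded for the factor m l. If l does not fit
    into c, no configuration of content c contains it. *)
Lemma sum_conf_weight_mult l c :
  \sum_(s <- level V (weight c) | occ s == c) (s l)%:R * conf_weight s =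
  if leqc (uloop_content l) c then m l * occ_weight (subc c (uloop_content l)) else 0.
Proof.
have le_occ s : occ s = c -> (0 < s l)%N -> leqc (uloop_content l) c.
  move=> <- sl; apply/forallP => v.
  by rewrite -(sublK sl) occ_addl leq_addl.
case: ifPn => [lec|/negP nle]; last first.
  rewrite big1// => s /eqP so.
  by have [->|sl] := posnP (s l); [rewrite mul0r|case: nle; exact: le_occ sl].
rewrite /occ_weight mulr_sumr; set c' := subc _ _.
have occE s : (occ (addl l s) == c) = (occ s == c').
  apply/eqP/eqP => [sc|sc']; apply/ffunP => v; first by rewrite [RHS]ffunE -sc occ_addl addnK.
  by rewrite occ_addl sc' ffunE subnK//; exact: (forallP lec).
transitivity (\sum_(s <- [seq s <- level V (weight c) | (occ s == c) && (0 < s l)%N])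
   (s l)%:R * conf_weight s).
  rewrite big_filter [LHS]big_mkcond [RHS]big_mkcond; apply: eq_bigr => s _.
  by case: eqP => //= _; case: posnP => // ->; rewrite mul0r.
rewrite (perm_big [seq addl l s | s <- level V (weight c') & occ s == c']).
  rewrite big_map big_filter; apply: eq_bigr => s _; exact: conf_weight_addl.
apply: uniq_perm; rewrite ?filter_uniq ?(map_inj_uniq (@addl_inj _ l)) ?filter_uniq ?uniq_level//.
move=> s; rewrite mem_filter mem_level; apply/andP/mapP => [[/andP[/eqP so sl] _]|].
  exists (subl l s); last by rewrite sublK.
  have so' : occ (subl l s) == c' by rewrite -occE sublK// so.
  by rewrite mem_filter mem_level so' (eqP so') eqxx.
move=> [s' + ->]; rewrite mem_filter => /andP[so _].
have so2 : occ (addl l s') == c by rewrite occE.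
by rewrite so2 (eqP so2) addlE !eqxx addn1.
Qed.

End configuration_weight.

Lemma occupation_uloops (V : finType) u (s : configuration V) :
  occupation u s =
  (\sum_(1 <= k < (weight (occ s)).+1) \sum_(l <- uloops V k) s l * uloop_time u l)%N.
Proof.
pose f l := (s l * uloop_time u l)%N.
have suppP l : l \in finsupp s -> (0 < uloop_length l < (weight (occ s)).+1)%N.
  by rewrite mem_finsupp -lt0n uloop_length_gt0 ltnS; exact: occ_neq0.
transitivity (\sum_(l <- finsupp s) \sum_(1 <= k < (weight (occ s)).+1 | uloop_length l == k) f l)%N.
  rewrite /occupation [LHS]big_seq [RHS]big_seq; apply: eq_bigr => l /suppP lk.
  rewrite big_mkcond (bigD1_seq (uloop_length l)) ?iota_uniq ?mem_index_iota//= eqxx.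
  by rewrite big1 ?addn0// => k; rewrite eq_sym => /negbTE ->.
rewrite (exchange_big_dep xpredT)//=; apply: eq_bigr => k _.
transitivity (\sum_(l <- uloops V k | l \in finsupp s) f l)%N.
  rewrite -[LHS]big_filter -[RHS]big_filter; apply: perm_big; apply: uniq_perm.
  - by rewrite filter_uniq// fset_uniq.
  - by rewrite filter_uniq// undup_uniq.
  - by move=> l; rewrite !mem_filter mem_uloops andbC.
rewrite big_mkcond; apply: eq_bigr => l _; case: ifPn => // ls.
by rewrite /f fsfun_dflt.
Qed.

Section loop_soup_coefficients.
Context (R : realType) (V : finType) (q : V -> V -> R[i]).

Lemma occ_weight_loop c : occ_weight (loop_measure q) c = diagcoef q c.
Proof.
apply: diagcoef_unique; first exact: occ_weight0.
move=> u {}c _; set B := occ_weight _.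
transitivity (\sum_(1 <= k < (weight c).+1) \sum_(l <- uloops V k)
   (uloop_time u l)%:R * \sum_(s <- level V (weight c) | occ s == c)
      (s l)%:R * conf_weight (loop_measure q) s).
  rewrite /B /occ_weight mulr_sumr.
  under [RHS]eq_bigr do under eq_bigr do rewrite mulr_sumr.
  under [RHS]eq_bigr do rewrite exchange_big /=.
  rewrite [RHS]exchange_big /=; apply: eq_bigr => s /eqP so.
  have -> : c u = occupation u s by rewrite -so ffunE.
  rewrite occupation_uloops so natr_sum mulr_suml; apply: eq_bigr => k _.
  rewrite natr_sum mulr_suml; apply: eq_bigr => l _.
  by rewrite natrM mulrA [_%:R * _%:R]mulrC.
apply: eq_big_nat => k /andP[k0 _].
(* [subc] is a truncated subtraction, so H must be set to 0 on contents that do not fit into c. *)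
pose H c' := if leqc c' c then B (subc c c') else 0.
transitivity (\sum_(l <- uloops V k) (uloop_time u l)%:R * loop_measure q l * H (uloop_content l)).
  apply: eq_bigr => l _; rewrite sum_conf_weight_mult /H -mulrA; congr (_ * _).
  by case: ifP; rewrite ?mulr0.
rewrite sum_loop_measure// /walk_sum big_mkcondr; apply: eq_bigr => p _.
by rewrite /H; case: ifP; rewrite ?mulr0.
Qed.

(* The degree n part of \sum_c diagcoef c t^c / \prod_v (c v)!: a content c is shared by
   n! / \prod_v (c v)! words. *)
Definition soup_coef (t : V -> R[i]) n : R[i] :=
  n`!%:R^-1 * \sum_(a <- words V n) lincoef q a (wcontent a) * \prod_(v <- a) t v.

(** Each configuration is spread evenly over the words that share its content, of which the
    multinomial count gives the number. Collecting by words instead leaves [occ_weight], that is, a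
    diagonal coefficient. *)
Lemma sum_level_soup (t : V -> R[i]) n :
  \sum_(s <- level V n) conf_weight (loop_measure q) s *
     \prod_v (t v ^+ occ s v / ((occ s v)`!)%:R) = soup_coef t n.
Proof.
transitivity (\sum_(s <- level V n) \sum_(a <- words V n | wcontent a == occ s)
  conf_weight (loop_measure q) s * (n`!%:R^-1 * \prod_(v <- a) t v)).
  rewrite [LHS]big_seq [RHS]big_seq; apply: eq_bigr => s; rewrite mem_level => /eqP sn.
  rewrite -mulr_sumr; congr (_ * _); rewrite -mulr_sumr.
  rewrite [X in _ = _ * X](eq_bigr (fun=> \prod_v t v ^+ occ s v)); last first.
    by move=> a /eqP <-; exact: prod_content.
  have := multinomial_words sn; rewrite sum1_count => mN.
  rewrite big_const_seq iter_addr_0 -[X in _ = _ * X]mulr_natl -mN natrM.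
  rewrite big_split /= prodfV -natr_prod -/(cfact _).
  have c0 : (cfact (occ s))%:R != 0 :> R[i].
    by rewrite pnatr_eq0 -lt0n; apply: prodn_gt0 => v; exact: fact_gt0.
  have N0 : (count (fun a : seq V => wcontent a == occ s) (words V n))%:R != 0 :> R[i].
    rewrite pnatr_eq0; apply/eqP => N0; have := fact_gt0 n.
    by rewrite -mN N0 muln0.
  move: (cfact _)%:R (count _ _)%:R (\prod_v _) c0 N0 => a b e a0 b0.
  by field; rewrite a0 b0.
rewrite (exchange_big_dep xpredT)//= /soup_coef mulr_sumr [LHS]big_seq [RHS]big_seq.
apply: eq_bigr => a an; rewrite -mulr_suml lincoef_diag -occ_weight_loop /occ_weight.
rewrite weight_wcontent (size_words an) mulrCA; congr (_ * (_ * _)).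
by apply: eq_bigl => s; rewrite eq_sym.
Qed.

End loop_soup_coefficients.

(** * Unordered sums as limits of partial sums by levels *)

Section sums_by_levels.
Context (R : realType) (I : choiceType) (L : I -> nat) (lv : nat -> seq I).
Hypotheses (mem_lv : forall n i, (i \in lv n) = (L i == n)) (uniq_lv : forall n, uniq (lv n)).

Let below n := [seq i | k <- iota 0 n, i <- lv k].

Let mem_below n i : (i \in below n) = (L i < n)%N.
Proof.
apply/allpairsPdep/idP => [[k [j [+ + ->]]]|Ln].
  by rewrite mem_iota mem_lv add0n => kn /eqP ->.
by exists (L i), i; rewrite mem_iota mem_lv eqxx.
Qed.

Let uniq_below n : uniq (below n).
Proof.
apply: allpairs_uniq_dep => [||[k i] [k' i']]; rewrite ?iota_uniq//.
move=> /allpairsPdep[a [b [_ + [-> ->]]]] /allpairsPdep[a' [b' [_ + [-> ->]]]].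
by rewrite !mem_lv /= => /eqP <- /eqP <- ->.
Qed.

(** Every finite set of indices lies below some level, so the partial sums by levels have the same
    supremum as all finite partial sums. *)
Lemma esum_levels (g : I -> \bar R) : (forall i, 0 <= g i)%E ->
  (\sum_(0 <= k < n) \sum_(i <- lv k) g i)%E @[n --> \oo] --> (\esum_(i in [set: I]) g i)%E.
Proof.
move=> g0; set u := (X in X @ \oo --> _).
have uE n : u n = (\sum_(i <- below n) g i)%E by rewrite /u big_allpairs_dep /index_iota subn0.
have ndu : nondecreasing_seq u.
  move=> m n mn; rewrite /u (@big_cat_nat _ _ _ m _ n)//= leeDl//.
  by apply: sume_ge0 => k _; apply: sume_ge0.
have -> : (\esum_(i in [set: I]) g i)%E = ereal_sup (range u).
  apply/eqP; rewrite eq_le; apply/andP; split.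
    apply: ge_ereal_sup => _ [A [finA _] <-].
    pose n := (\max_(i <- fset_set A) L i).+1.
    apply: (@le_trans _ _ (u n)); last by apply: ereal_sup_ubound; exists n.
    rewrite fsbig_finite//= uE.
    rewrite [leRHS](bigID (fun i => i \in fset_set A))/=.
    rewrite [X in (_ <= X + _)%E](_ : _ = \sum_(i <- fset_set A) g i)%E; last first.
      rewrite -big_filter; apply: perm_big; apply: uniq_perm; rewrite ?filter_uniq//.
      move=> i; rewrite mem_filter mem_below; apply: andb_idr => iA.
      by rewrite ltnS (leq_bigmax_seq _ iA).
    by rewrite leeDl//; apply: sume_ge0.
  apply: ge_ereal_sup => _ [n _ <-]; apply: ereal_sup_ubound.
  exists [set` below n]; first by split.
  by rewrite -fsbig_seq// uE.
exact: ereal_nondecreasing_cvgn.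
Qed.

Lemma csummable_levels (f : I -> R[i]) (C : R) :
  (forall n, \sum_(0 <= k < n) \sum_(i <- lv k) Normc.normc (f i) <= C) -> csummable f.
Proof.
move=> fC; rewrite /csummable /summable.
apply: (@le_lt_trans _ _ C%:E); last exact: ltry.
have := @esum_levels (fun i => `|(Normc.normc (f i))%:E|%E) (fun=> abse_ge0 _).
move=> /cvg_lim <-//; apply: lime_le.
  apply: ereal_nondecreasing_is_cvgn => m n mn; rewrite (@big_cat_nat _ _ _ m _ n)//= leeDl//.
  by apply: sume_ge0 => k _; apply: sume_ge0.
apply: nearW => n; move: (fC n); rewrite -lee_fin; apply: le_trans.
rewrite -sumEFin; apply: lee_sum => k _; rewrite -sumEFin; apply: lee_sum => i _.
by rewrite gee0_abs// lee_fin; case: (f i) => a b; exact: sqrtr_ge0.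
Qed.

(** Positive and negative parts converge separately. Summability makes both sums finite, so [fine]
    loses nothing and the limits may be subtracted. *)
Lemma rsum_levels (g : I -> R) : summable [set: I] (EFin \o g) ->
  \sum_(0 <= k < n) \sum_(i <- lv k) g i @[n --> \oo] --> rsum g.
Proof.
move=> gs; rewrite /rsum.
have part (h : I -> \bar R) : (forall i, 0 <= h i)%E -> summable [set: I] h ->
    \sum_(0 <= k < n) \sum_(i <- lv k) fine (h i) @[n --> \oo] --> fine (\esum_(i in [set: I]) h i).
  move=> h0 hs; have hE i : (fine (h i))%:E = h i.
    by rewrite fineK// ge0_fin_numE//; have := summable_pinfty hs (Logic.I : [set: _] i); rewrite gee0_abs.
  have sfin : (\esum_(i in [set: I]) h i)%E \is a fin_num.
    rewrite ge0_fin_numE; last by apply: esum_ge0.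
    by move: hs; rewrite /summable; under eq_esum do rewrite gee0_abs//.
  have := @esum_levels h h0; rewrite -[X in _ --> X](fineK sfin).
  move=> /fine_cvg; apply: cvg_trans; apply: near_eq_cvg; apply: nearW => n /=.
  by rewrite -[RHS]/(fine (_%:E)) -sumEFin; congr fine; apply: eq_bigr => k _;
    rewrite -sumEFin; apply: eq_bigr => i _.
rewrite (_ : (fun n => _) = (fun n => \sum_(0 <= k < n) \sum_(i <- lv k) fine ((EFin \o g)^\+%E i)) \-
   (fun n => \sum_(0 <= k < n) \sum_(i <- lv k) fine ((EFin \o g)^\-%E i))); last first.
  apply/funext => n /=; rewrite -sumrB; apply: eq_bigr => k _; rewrite -sumrB; apply: eq_bigr => i _.
  rewrite funeposE funenegE /= -!EFin_max /=.
  have [gi|/ltW gi] := leP 0 (g i).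
    by rewrite max_r ?oppr_le0// subr0.
  by rewrite max_l ?oppr_ge0// sub0r opprK.
apply: cvgB.
- by apply: (part (funepos (EFin \o g))) => [i|]; [exact: funepos_ge0|exact: summable_funepos].
- by apply: (part (funeneg (EFin \o g))) => [i|]; [exact: funeneg_ge0|exact: summable_funeneg].
Qed.

Lemma csum_levels (f : I -> R[i]) : csummable f ->
  (complex.Re (\sum_(0 <= k < n) \sum_(i <- lv k) f i) @[n --> \oo] --> complex.Re (csum f)) /\
  (complex.Im (\sum_(0 <= k < n) \sum_(i <- lv k) f i) @[n --> \oo] --> complex.Im (csum f)).
Proof.
move=> fs.
have norm (g : I -> R) : (forall i, `|g i| <= Normc.normc (f i)) -> summable [set: I] (EFin \o g).
  move=> gf; apply: le_lt_trans fs; apply: le_esum => i _ /=; rewrite lee_fin.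
  by rewrite (le_trans (gf i))// ler_norm.
have sq (a b : R) : `|a| <= Num.sqrt (a ^+ 2 + b ^+ 2).
  by rewrite -sqrtr_sqr ler_sqrt ?lerDl ?sqr_ge0// addr_ge0 ?sqr_ge0.
split.
- rewrite (_ : (fun n => _) = fun n => \sum_(0 <= k < n) \sum_(i <- lv k) complex.Re (f i)).
    by apply/rsum_levels/norm => i; case: (f i) => a b; exact: sq.
  by apply/funext => n; rewrite raddf_sum; apply: eq_bigr => k _; rewrite raddf_sum.
- rewrite (_ : (fun n => _) = fun n => \sum_(0 <= k < n) \sum_(i <- lv k) complex.Im (f i)).
    by apply/rsum_levels/norm => i; case: (f i) => a b; rewrite /= addrC; exact: sq.
  by apply/funext => n; rewrite raddf_sum; apply: eq_bigr => k _; rewrite raddf_sum.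
Qed.

End sums_by_levels.

(** * The mass of the loop measure *)

(** [g n u] is the remainder of the series at u x. The geometric sum collapses its derivative in u
    to [dg n u], and the mean value theorem on [0, 1], with [g n 0] = 0, bounds the remainder at x
    by a multiple of |x|^n. *)
Lemma cvg_ln_series (R : realType) (x : R) : `|x| < 1 ->
  \sum_(1 <= k < n) x ^+ k / k%:R @[n --> \oo] --> - ln (1 - x).
Proof.
move=> x1.
pose g n (u : R) : R := ln (1 - u * x) + \sum_(i < n) (u * x) ^+ i.+1 / i.+1%:R.
pose dg n (u : R) : R := - (x * (u * x) ^+ n / (1 - u * x)).
have ux (u : R) : 0 <= u <= 1 -> `|u * x| <= `|x|.
  by move=> /andP[u0 u1]; rewrite normrM ger0_norm// ler_piMl.
have ux1 (u : R) : 0 <= u <= 1 -> 0 < 1 - u * x.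
  move=> u01; rewrite subr_gt0 (le_lt_trans (ler_norm _))//.
  by rewrite (le_lt_trans (ux _ u01)).
have gE n (u : R) : 0 <= u <= 1 -> is_derive u 1 (g n : R -> R) (dg n u).
  move=> u01; have u0 := ux1 _ u01.
  have d0 : is_derive u 1 (fun u : R => u * x) x.
    by apply: is_derive_eq; rewrite scaler0 add0r -[_ *: _]/(_ * _) mulr1.
  have d1 : is_derive u 1 (fun u : R => 1 - u * x) (- x).
    by apply: is_derive_eq; rewrite add0r mul1r.
  have d2 := @is_derive1_comp R (@ln R) (fun u : R => 1 - u * x) u _ _ (is_derive1_ln u0) d1.
  have d3 : is_derive u 1 (\sum_(i < n) (fun u : R => (u * x) ^+ i.+1 / i.+1%:R))
      (\sum_(i < n) x * (u * x) ^+ i).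
    apply: is_derive_sum => i.
    have -> : (fun u : R => (u * x) ^+ i.+1 / i.+1%:R) =
       i.+1%:R^-1 *: (fun u : R => u * x) ^+ i.+1.
      by apply/funext => v; rewrite scalrfctE exprfctE mulrC.
    apply: is_derive_eq; rewrite -[_ *: x]/(_ * x) -[_ *: _]/(_ * _) /= -mulrA mulKf ?pnatr_eq0//.
    by rewrite mulrC.
  have -> : g n = (@ln R \o (fun u : R => 1 - u * x)) + \sum_(i < n) (fun u : R => (u * x) ^+ i.+1 / i.+1%:R).
    by apply/funext => v; rewrite /g /= fct_sumE.
  apply: is_derive_eq; rewrite /dg -mulr_sumr.
  have := subrX1 (u * x) n => h.
  apply: (@mulIf _ (1 - u * x)); first by rewrite gt_eqF.
  rewrite mulrDl mulrN mulNr mulrAC mulVf ?gt_eqF// mul1r mulNr divfK ?gt_eqF//.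
  by rewrite -mulrA [X in _ + x * X]mulrC -opprB mulNr -h; ring.
have bound n : `|g n 1| <= `|x| ^+ n * (`|x| / (1 - `|x|)).
  have [|||c] := @MVT_segment R (g n) (dg n) 0 1; first exact: ler01.
  - by move=> u; rewrite in_itv /= => /andP[u0 u1]; apply: gE; rewrite !ltW.
  - by apply: derivable_within_continuous => u; rewrite in_itv /= => u01; have [] := gE n u u01.
  rewrite in_itv /= => c01; rewrite subr0 mulr1.
  have -> : g n 0 = 0.
    rewrite /g mul0r subr0 ln1 add0r big1// => i _.
    by rewrite expr0n /= mul0r.
  rewrite subr0 => ->; rewrite /dg normrN normrM normrM normrX normfV.
  rewrite (gtr0_norm (ux1 _ c01)) mulrAC mulrC.
  apply: ler_pM => //; [|by apply: lerXn2r; rewrite ?nnegrE// ux|].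
    by rewrite divr_ge0// ltW// ux1.
  have x10 : 0 < 1 - `|x| by rewrite subr_gt0.
  rewrite ler_wpM2l// lef_pV2 ?posrE ?ux1//.
  by rewrite lerB// (le_trans (ler_norm _))// ux.
have g0 : g n 1 @[n --> \oo] --> (0 : R).
  apply/norm_cvg0P; apply: (@squeeze_cvgr _ _ _ _ (cst 0) (fun n => `|x| ^+ n * (`|x| / (1 - `|x|)))).
  - by apply: nearW => n; rewrite /= normr_ge0 bound.
  - exact: cvg_cst.
  - rewrite -[X in _ --> X](mul0r (`|x| / (1 - `|x|))); apply: cvgMl.
    by apply: cvg_expr; rewrite normr_id.
rewrite -(cvg_shiftS (fun n => \sum_(1 <= k < n) x ^+ k / k%:R)).
have -> : (fun n => \sum_(1 <= k < n.+1) x ^+ k / k%:R) = fun n => - ln (1 - x) + g n 1.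
  by apply/funext => n; rewrite /g mul1r addKr big_add1 big_mkord.
have cs : (fun=> - ln (1 - x)) @ \oo --> - ln (1 - x) by exact: cvg_cst.
have gs := cvgD cs g0; rewrite addr0 in gs; exact: gs.
Qed.

(** * Traces, determinants and eigenvalues of Hermitian matrices *)

Section spectral.
Context (C : numClosedFieldType) (n : nat) (A : 'M[C]_n).
Hypothesis hA : A \is hermsymmx.

Let P := spectralmx A.
Let d := spectral_diag A.

Let AE : A = invmx P *m diag_mx d *m P.
Proof. exact/orthomx_spectralP/hermitian_normalmx. Qed.

Let Pu : P \in unitmx. Proof. exact: spectral_unit. Qed.

Lemma hermitian_expE k : A ^+ k = invmx P *m diag_mx (map_mx (fun a => a ^+ k) d) *m P.
Proof.
elim: k => [|k IHk].
  rewrite expr0 (_ : diag_mx _ = 1%:M) ?mulmx1 ?mulVmx//.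
  by apply/matrixP => i j; rewrite !mxE expr0.
rewrite exprS IHk {1}AE -[_ * _]/(_ *m _) !mulmxA (mulmxK Pu) -!mulmxA; congr (_ *m _).
rewrite !mulmxA; congr (_ *m _); rewrite mulmx_diag; congr diag_mx.
by apply/rowP => i; rewrite !mxE exprS.
Qed.

Lemma hermitian_tr_exp k : \tr (A ^+ k) = \sum_i (d 0 i) ^+ k.
Proof.
rewrite hermitian_expE -mulmxA mxtrace_mulC -mulmxA mulmxV// mulmx1 mxtrace_diag.
by apply: eq_bigr => i _; rewrite mxE.
Qed.

Lemma hermitian_det1B : \det (1%:M - A) = \prod_i (1 - d 0 i).
Proof.
rewrite {1}AE (_ : 1%:M - _ = invmx P *m diag_mx (const_mx 1 - d) *m P).
  rewrite !det_mulmx mulrAC -det_mulmx mulVmx// det1 mul1r det_diag.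
  by apply: eq_bigr => i _; rewrite !mxE.
rewrite linearB/= mulmxBr mulmxBl diag_const_mx mulmx1 mulVmx//.
Qed.

(** Eigenvectors are row vectors here, so row i of the diagonalizing matrix is one; it is nonzero
    because that matrix is invertible. *)
Lemma eigenvalue_spectral_diag i : eigenvalue A (d 0 i).
Proof.
apply/eigenvalueP; exists (row i P).
  by rewrite {1}AE !mulmxA -row_mul mulmxV// row1 -rowE row_diag_mx -scalemxAl -rowE.
apply: contraTneq Pu => Pi0; rewrite -row_free_unit.
apply/negP => /row_freeP[B PB]; have := congr1 (row i) PB.
by rewrite row_mul Pi0 mul0mx row1 => /rowP/(_ i) /eqP; rewrite !mxE !eqxx eq_sym oner_eq0.
Qed.

End spectral.

Lemma eigenvalues_seq (C : numClosedFieldType) (n : nat) (A : 'M[C]_n) :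
  exists rs : seq C, forall a, eigenvalue A a -> a \in rs.
Proof.
have [rs rsE] := closed_field_poly_normal (char_poly A); exists rs => a.
rewrite eigenvalue_root_char rsE rootZ ?root_prod_XsubC//.
by rewrite (monicP (char_poly_monic A)) oner_neq0.
Qed.

(** A supremum dominates its set only if the set is bounded above. The eigenvalues are among the
    finitely many roots of the characteristic polynomial, and the sum of the moduli of these roots
    is a bound. *)
Lemma spectral_radius_ge (R : realType) n (A : 'M[R[i]]_n) a :
  eigenvalue A a -> Normc.normc a <= spectral_radius A.
Proof.
move=> Aa; apply: sup_ubound; last by exists a.
have [rs rsE] := eigenvalues_seq A; exists (\sum_(r <- rs) Normc.normc r) => _ [b /= Ab <-].
rewrite (big_rem b) ?rsE//= lerDl; apply: sumr_ge0 => -[x y] _.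
exact: sqrtr_ge0.
Qed.

Section hermitian_weight.
Context (R : realType) (V : finType) (q : V -> V -> R[i]).

Lemma weight_mx_expE k (i j : 'I_#|V|) :
  (weight_mx q ^+ k) i j =
  \sum_(p <- words V k | last (enum_val i) p == enum_val j)
    pair_weight q (enum_val i :: p) p.
Proof.
elim: k i j => [|k IHk] i j.
  rewrite expr0 mxE big_mkcond big_seq1 /= /pair_weight big_nil (inj_eq enum_val_inj).
  by case: eqP.
rewrite exprS mxE big_words_cons (reindex_onto enum_rank enum_val) /=; last first.
  by move=> l _; rewrite enum_valK.
rewrite (eq_bigl xpredT); last by move=> v; rewrite enum_rankK eqxx.
apply: eq_bigr => v _; rewrite mxE IHk enum_rankK mulr_sumr; apply: eq_bigr => p _.
by rewrite /pair_weight /= big_cons.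
Qed.

Lemma weight_mx_tr k :
  \tr (weight_mx q ^+ k) =
  \sum_v \sum_(p <- words V k | last v p == v) pair_weight q (v :: p) p.
Proof.
rewrite /mxtrace (reindex_onto enum_rank enum_val) /=; last first.
  by move=> l _; rewrite enum_valK.
rewrite (eq_bigl xpredT); last by move=> v; rewrite enum_rankK eqxx.
by apply: eq_bigr => v _; rewrite weight_mx_expE !enum_rankK.
Qed.

Lemma sum_uloops_measure k : (0 < k)%N ->
  \sum_(l <- uloops V k) loop_measure q l = \tr (weight_mx q ^+ k) / k%:R.
Proof.
move=> k0; rewrite weight_mx_tr mulr_suml.
under [RHS]eq_bigr do rewrite mulr_suml.
rewrite -(big_rloops (fun w => path_weight q w / k%:R))//.
transitivity (\sum_(w <- rloops V k) 1 * (path_weight q (val w) / k%:R)); last first.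
  by apply: eq_bigr => w _; rewrite mul1r.
rewrite -(big_uloops k (fun=> 1)) [LHS]big_seq [RHS]big_seq; apply: eq_bigr => l.
by rewrite mem_uloops mul1r => /eqP; exact: loop_measureE.
Qed.

End hermitian_weight.

Lemma cvgn_sum (R : realType) (I : Type) (s : seq I) (f : I -> nat -> R) (l : I -> R) :
  (forall i, f i n @[n --> \oo] --> l i) ->
  \sum_(i <- s) f i n @[n --> \oo] --> \sum_(i <- s) l i.
Proof.
move=> fl; elim: s => [|i s IHs].
  by rewrite big_nil; under eq_fun do rewrite big_nil; exact: cvg_cst.
by rewrite big_cons; under eq_fun do rewrite big_cons; exact: cvgD.
Qed.

Section loop_measure_mass.
Context (R : realType) (V : finType) (q : V -> V -> R[i]).

Definition abs_weight (u v : V) : R[i] := `|q u v|.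

Lemma norm_pair_weight a b : `|pair_weight q a b| = pair_weight abs_weight a b.
Proof. by rewrite /pair_weight normr_prod. Qed.

Lemma abs_weight_mx : weight_mx abs_weight = map_mx (fun z : R[i] => `|z|) (weight_mx q).
Proof. by apply/matrixP => i j; rewrite !mxE. Qed.

Lemma norm_loop_measure l : `|loop_measure q l| <= loop_measure abs_weight l.
Proof.
rewrite !(loop_measureE _ (erefl (uloop_length l))) (le_trans (ler_norm_sum _ _ _))//.
apply: ler_sum => w _; rewrite normrM normfV normr_nat.
by rewrite !path_weightE norm_pair_weight.
Qed.

Lemma norm_weight_mx_tr k : `|\tr (weight_mx q ^+ k)| <= \tr (weight_mx abs_weight ^+ k).
Proof.
rewrite !weight_mx_tr (le_trans (ler_norm_sum _ _ _))//; apply: ler_sum => u _.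
rewrite (le_trans (ler_norm_sum _ _ _))//; apply: ler_sum => p _.
by rewrite norm_pair_weight.
Qed.

Hypotheses (q_integrable : integrable_weight q) (q_hermitian : hermitian_weight q).

Lemma hermitian_weightE u v : q v u = (q u v)^*%C.
Proof.
have /is_hermitianmxP/matrixP/(_ (enum_rank v) (enum_rank u)) := q_hermitian.
by rewrite expr0 scale1r !mxE !enum_rankK.
Qed.

Lemma abs_weight_hermitian : weight_mx abs_weight \is hermsymmx.
Proof.
apply/is_hermitianmxP/matrixP => i j; rewrite expr0 scale1r !mxE /abs_weight.
by rewrite hermitian_weightE normcJ; apply/esym/CrealP; rewrite realE normr_ge0.
Qed.

(** |Q| inherits Hermitian symmetry from Q, so the trace of its k-th power is a sum of |V| k-th
    powers of eigenvalues, each at most the spectral radius in modulus. The maximum with 0 in the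
    witness gives r >= 0 outright. *)
Lemma abs_weight_tr_le : exists2 r : R, 0 <= r < 1 &
  forall k, \tr (weight_mx abs_weight ^+ k) <= (#|V|%:R * r ^+ k)%:C.
Proof.
exists (Num.max 0 (spectral_radius (weight_mx abs_weight))).
  rewrite le_max lexx /= gt_max ltr01 /=.
  by rewrite abs_weight_mx.
set r := Num.max _ _ => k; rewrite (hermitian_tr_exp abs_weight_hermitian).
apply: (@le_trans _ _ (\sum_(i < #|V|) (r ^+ k)%:C)); last first.
  by rewrite sumr_const card_ord -raddfMn /= mulr_natl.
rewrite (le_trans (real_ler_norm _))//.
  rewrite -(hermitian_tr_exp abs_weight_hermitian).
  exact: ger0_real (le_trans (normr_ge0 _) (norm_weight_mx_tr k)).
rewrite (le_trans (ler_norm_sum _ _ _))//; apply: ler_sum => i _; rewrite normrX rmorphXn /=.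
apply: lerXn2r; rewrite ?nnegrE ?normr_ge0//.
  by rewrite lecR le_max lexx.
rewrite normc_def lecR le_max; apply/orP; right.
have := spectral_radius_ge (eigenvalue_spectral_diag abs_weight_hermitian i).
by case: (spectral_diag _ 0 i).
Qed.

(** The loops of length k > 0 carry at most tr |Q|^k / k; dropping 1 / k leaves a geometric series,
    whence the bound |V| / (1 - r). There are no loops of length 0. *)
Lemma sum_norm_loop_measure : exists C : R, forall n,
  \sum_(0 <= k < n) \sum_(l <- uloops V k) Normc.normc (loop_measure q l) <= C.
Proof.
have [r /andP[r0 r1] tr_le] := abs_weight_tr_le.
exists (#|V|%:R / (1 - r)) => n.
apply: (@le_trans _ _ (\sum_(0 <= k < n) #|V|%:R * r ^+ k)).
  apply: ler_sum => -[_|k _].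
    rewrite big1_seq ?mulr_ge0// => l /andP[_].
    by rewrite mem_uloops => /eqP l0; have := uloop_length_gt0 l; rewrite l0.
  rewrite -lecR rmorph_sum /=; apply: le_trans (tr_le k.+1).
  apply: (@le_trans _ _ (\sum_(l <- uloops V k.+1) loop_measure abs_weight l)).
    apply: ler_sum => l _; apply: le_trans (norm_loop_measure l).
    by rewrite normc_def; case: (loop_measure q l).
  rewrite sum_uloops_measure// ler_piMr//.
    by apply: le_trans (norm_weight_mx_tr k.+1).
  by rewrite invf_le1 ?ltr0n// ler1n.
rewrite -mulr_sumr ler_wpM2l// big_mkord.
rewrite -(@ler_pM2l _ (1 - r)) ?subr_gt0// mulfV ?gt_eqF ?subr_gt0//.
by rewrite -opprB mulNr -subrX1 opprB gerBl exprn_ge0.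
Qed.

Lemma csummable_loop_measure : csummable (loop_measure q).
Proof.
have [C leC] := sum_norm_loop_measure.
apply: (csummable_levels (@mem_uloops V)) leC.
by move=> n; exact: undup_uniq.
Qed.

(** The hypothesis bounds the spectrum of |Q|, not that of Q; traces link the two. In tr Q^(2k) the
    summands are even powers of reals and cannot cancel, so an eigenvalue of modulus at least 1
    would keep this trace at least 1, whereas it is at most tr |Q|^(2k) <= |V| r^(2k), which tends
    to 0. *)
Lemma weight_eigen_real : exists2 a : 'I_#|V| -> R,
  (forall k, \tr (weight_mx q ^+ k) = (\sum_i a i ^+ k)%:C) /\
  \det (1%:M - weight_mx q) = (\prod_i (1 - a i))%:C & forall i, `|a i| < 1.
Proof.
pose d i := spectral_diag (weight_mx q) 0 i.
have dreal i : d i = (complex.Re (d i))%:C.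
  have /mxOverP/(_ 0 i) /complex_realP[x xE] := hermitian_spectral_diag_real q_hermitian.
  by rewrite /d xE.
exists (fun i => complex.Re (d i)).
  split => [k|].
    rewrite (hermitian_tr_exp q_hermitian) rmorph_sum; apply: eq_bigr => i _ /=.
    by rewrite rmorphXn /= -dreal.
  rewrite (hermitian_det1B q_hermitian) rmorph_prod; apply: eq_bigr => i _ /=.
  by rewrite rmorphB /= -dreal.
move=> i; rewrite ltNge; apply/negP => a1.
have [r /andP[r0 r1] tr_le] := abs_weight_tr_le.
have le1 k : 1 <= #|V|%:R * (r ^+ 2) ^+ k.
  rewrite -exprM -lecR; apply: le_trans (tr_le _).
  apply: le_trans (norm_weight_mx_tr _).
  rewrite (hermitian_tr_exp q_hermitian).
  rewrite (_ : \sum_i _ = (\sum_i (complex.Re (d i) ^+ 2) ^+ k)%:C); last first.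
    rewrite rmorph_sum; apply: eq_bigr => j _.
    by rewrite [_ 0 j]dreal /= -exprM rmorphXn.
  have s0 : 0 <= \sum_i (complex.Re (d i) ^+ 2) ^+ k.
    by apply: sumr_ge0 => j _; rewrite exprn_ge0// sqr_ge0.
  rewrite ger0_norm ?lecR// (bigD1 i)//= ler_wpDr//.
    by apply: sumr_ge0 => j _; rewrite exprn_ge0// sqr_ge0.
  by rewrite exprn_ege1// -real_normK ?num_real// exprn_ege1.
have : 1 <= (0 : R).
  have c0 : #|V|%:R * (r ^+ 2) ^+ k @[k --> \oo] --> #|V|%:R * (0 : R).
    apply: cvgMr; apply: cvg_expr.
    by rewrite ger0_norm ?sqr_ge0// exprn_ilt1.
  rewrite -[leRHS](mulr0 #|V|%:R) -(cvg_lim _ c0)//.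
  by apply: limr_ge; [apply/cvg_ex; eexists; exact: c0|apply: nearW => k; exact: le1].
by rewrite ler10.
Qed.

(** With real eigenvalues a i of modulus below 1, the mass is the real number - \sum_i ln (1 - a i),
    so real logarithms suffice and kappa = \prod_i (1 - a i) is positive. *)
Lemma cexp_loop_mass : exists2 kappa : R, 0 < kappa &
  cexp (- csum (loop_measure q)) = kappa%:C /\
  \det (1%:M - weight_mx q) = kappa%:C.
Proof.
have [a [trE detE] a1] := weight_eigen_real.
have a1_gt0 i : 0 < 1 - a i by rewrite subr_gt0 (le_lt_trans (ler_norm _)).
exists (\prod_i (1 - a i)); first exact: prodr_gt0.
split=> //.
have [cRe cIm] := csum_levels (@mem_uloops V) (fun n => undup_uniq _) csummable_loop_measure.
have partE n : \sum_(0 <= k < n) \sum_(l <- uloops V k) loop_measure q l =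
    (\sum_i \sum_(1 <= k < n) a i ^+ k / k%:R)%:C.
  rewrite exchange_big rmorph_sum /=.
  case: n => [|n]; first by rewrite !big_geq.
  rewrite big_nat_recl// big1_seq ?add0r => [|l /andP[_]]; last first.
    by rewrite mem_uloops => /eqP l0; have := uloop_length_gt0 l; rewrite l0.
  rewrite big_add1; apply: eq_bigr => k _; rewrite sum_uloops_measure// trE.
  rewrite -mulr_suml rmorphM /= fmorphV /= rmorph_nat//.
have -> : csum (loop_measure q) = (\sum_i - ln (1 - a i))%:C.
  apply/eqP; rewrite eq_complex /=; apply/andP; split; apply/eqP.
    apply: (@cvg_unique _ (@norm_hausdorff _ R^o)) cRe _.
    rewrite (_ : (fun n => _) = (fun n => \sum_i \sum_(1 <= k < n) a i ^+ k / k%:R)).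
      by apply: cvgn_sum => i; exact: cvg_ln_series.
    by apply/funext => n; rewrite partE.
  apply: (@cvg_unique _ (@norm_hausdorff _ R^o)) cIm _.
  rewrite (_ : (fun n => _) = cst 0); first exact: cvg_cst.
  by apply/funext => n; rewrite partE.
rewrite -rmorphN /cexp /= ?oppr0 cos0 sin0.
have -> : (1 +i* 0)%C = 1 :> R[i] by [].
rewrite mulr1 -sumrN expR_sum; congr (_%:C); apply: eq_bigr => i _.
by rewrite opprK lnK// posrE.
Qed.

End loop_measure_mass.

(** * The occupation density as an angular average *)

(** Take a root of 1 + X + ... + X^(p-1). Its order divides p, and it is not 1, where the polynomial
    has the value p. *)
Lemma prime_root_of_unity (C : numClosedFieldType) p : prime p ->
  exists om : C, p.-primitive_root om.
Proof.
move=> pp; have p1 := prime_gt1 pp.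
have /closed_rootP[om] : size (\poly_(i < p) (1 : C)) != 1%N.
  by rewrite size_poly_eq ?oner_neq0// gtn_eqF.
rewrite /root horner_poly => /eqP; under eq_bigr do rewrite mul1r.
move=> om0; exists om.
have omp : om ^+ p = 1.
  by apply/eqP; rewrite -subr_eq0 subrX1 om0 mulr0.
have [k kom] := prim_order_exists (prime_gt0 pp) omp.
move=> /(primeP pp).2 => /orP[/eqP k1|/eqP <-//].
rewrite k1 in kom; have := prim_expr_order kom; rewrite expr1 => om1.
move: om0; rewrite om1; under eq_bigr do rewrite expr1n.
rewrite sumr_const card_ord => /eqP; rewrite pnatr_eq0 => /eqP p0.
by rewrite p0 in p1.
Qed.

Lemma norm_unity_root (C : numClosedFieldType) p (om : C) : p.-primitive_root om -> `|om| = 1.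
Proof.
move=> omP; have p0 := prim_order_gt0 omP.
by apply/eqP; rewrite -(@pexpr_eq1 _ _ p)// -normrX (prim_expr_order omP) normr1.
Qed.

Section soup_coefficients.
Context (R : realType) (V : finType) (q : V -> V -> R[i]).
Implicit Types (x y : V -> R[i]).

Definition sesq_norm x y : R[i] := sesq (abs_weight q) (fun u => `|x u|) (fun v => `|y v|).

Lemma norm_sesq x y : `|sesq q x y| <= sesq_norm x y.
Proof.
rewrite (le_trans (ler_norm_sum _ _ _))//; apply: ler_sum => u _.
rewrite (le_trans (ler_norm_sum _ _ _))//; apply: ler_sum => v _.
by rewrite !normrM.
Qed.

Lemma soup_coef_phase p om n x y : p.-primitive_root om -> (n < p)%N ->
  (p ^ #|V|)%:R^-1 * \sum_(j : {ffun V -> 'I_p})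
    (sesq q (fun u => x u * om ^- j u) (fun v => y v * om ^+ j v) ^+ n / n`!%:R) =
  soup_coef q (fun u => x u * y u) n.
Proof.
move=> omP np; rewrite -mulr_suml (phase_average q omP _ _ np) -mulrA mulKf.
  by rewrite mulrC.
by rewrite pnatr_eq0 expn_eq0 negb_and -lt0n (prim_order_gt0 omP).
Qed.

(** Triangle inequality in the phase average for any prime p > n: rotating phases leaves the moduli
    of x and y unchanged, so every term obeys the same bound. This supplies the exponential majorant
    for the density. *)
Lemma norm_soup_coef x y n :
  `|soup_coef q (fun u => x u * y u) n| <= sesq_norm x y ^+ n / n`!%:R.
Proof.
have [p np pp] := prime_above n.
have [om omP] := prime_root_of_unity R[i] pp.
have p0 : (p ^ #|V|)%:R != 0 :> R[i].
  by rewrite pnatr_eq0 expn_eq0 negb_and -lt0n (prim_order_gt0 omP).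
rewrite -(soup_coef_phase _ _ omP np) normrM normfV normr_nat.
rewrite ler_pdivrMl ?lt0r ?p0 ?ler0n//.
apply: (@le_trans _ _ (\sum_(j : {ffun V -> 'I_p}) (sesq_norm x y ^+ n / n`!%:R))); last first.
  by rewrite sumr_const card_ffun card_ord mulr_natl.
rewrite (le_trans (ler_norm_sum _ _ _))//; apply: ler_sum => j _.
rewrite normrM normfV normr_nat ler_wpM2r ?invr_ge0// normrX.
apply: lerXn2r; rewrite ?nnegrE//.
  by apply: sumr_ge0 => u _; apply: sumr_ge0 => v _; rewrite !mulr_ge0// normr_ge0.
rewrite (le_trans (norm_sesq _ _))//; apply: ler_sum => u _; apply: ler_sum => v _.
by rewrite !normrM normfV !normrX (norm_unity_root omP) !expr1n invr1 !mulr1.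
Qed.

End soup_coefficients.

Lemma expR_series (R : realType) (x : R) :
  \sum_(0 <= k < n) x ^+ k / k`!%:R @[n --> \oo] --> expR x.
Proof. exact: is_cvg_series_exp_coeff. Qed.

Lemma expR_partial_le (R : realType) (x : R) n : 0 <= x ->
  \sum_(0 <= k < n) x ^+ k / k`!%:R <= expR x.
Proof.
move=> x0; have c := @expR_series R x.
rewrite -(cvg_lim _ c)//; apply: nondecreasing_cvgn_le; last first.
  by apply/cvg_ex; eexists; exact: c.
move=> m k mk; rewrite (@big_cat_nat _ _ _ m _ k)//= lerDl; apply: sumr_ge0 => i _.
by rewrite divr_ge0// exprn_ge0.
Qed.

Lemma norm_conf_weight (K : numFieldType) (V : finType) (m m' : unrooted_loop V -> K) s :
  (forall l, `|m l| <= m' l) -> `|conf_weight m s| <= conf_weight m' s.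
Proof.
move=> mm'; rewrite normr_prod; apply: ler_prod => l _.
rewrite normr_ge0 normrM normfV normr_nat normrX /= ler_wpM2r ?invr_ge0//.
by apply: lerXn2r; rewrite ?nnegrE// (le_trans _ (mm' l)).
Qed.

Section density.
Context (R : realType) (V : finType) (q : V -> V -> R[i]) (kappa : R).
Hypotheses (kappa_gt0 : 0 < kappa) (kappaE : cexp (- csum (loop_measure q)) = kappa%:C).
Implicit Types (t : realvec R #|V|).

Definition vertex_coord t (v : V) : R := vcoord t (enum_rank v).

Definition sqrt_coord t (v : V) : R[i] := (Num.sqrt (vertex_coord t v))%:C.

(* The common factor of all [occupation_term]s, where kappa = exp (- m(L)). *)
Definition damping t : R := kappa * expR (- \sum_v vertex_coord t v).

(** The bound \sum |q_uv| sqrt (t_u t_v) on |<z,Qz>|, valid for all z with |z_v|^2 = t_v, whatever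
    their phases. *)
Definition amplitude t : R := complex.Re (sesq_norm q (sqrt_coord t) (sqrt_coord t)).

Lemma sesq_norm_real x y : sesq_norm q x y = (complex.Re (sesq_norm q x y))%:C.
Proof.
have : 0 <= sesq_norm q x y.
  by apply: sumr_ge0 => u _; apply: sumr_ge0 => v _; rewrite !mulr_ge0// normr_ge0.
by move=> /ger0_real /complex_realP[z ->].
Qed.

Lemma amplitude_ge0 t : 0 <= amplitude t.
Proof.
rewrite -lecR -sesq_norm_real.
by apply: sumr_ge0 => u _; apply: sumr_ge0 => v _; rewrite !mulr_ge0// normr_ge0.
Qed.

Lemma occupation_termE t s : occupation_term q t s =
  (damping t)%:C * (conf_weight (loop_measure q) s *
    \prod_v ((vertex_coord t v)%:C ^+ occ s v / (occ s v)`!%:R)).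
Proof.
rewrite /occupation_term /loop_soup kappaE -/(conf_weight _ s) /damping.
rewrite rmorph_prod /= rmorphM /= -!mulrA; congr (_ * _).
rewrite mulrCA; congr (_ * _); rewrite -sumrN expR_sum rmorph_prod -big_split /=.
apply: eq_bigr => v _; rewrite !rmorphM /= rmorphXn fmorphV /= rmorph_nat !ffunE.
by rewrite -/(vertex_coord t v) -mulrA mulrCA.
Qed.

Lemma sum_level_occupation_term t n :
  \sum_(s <- level V n) occupation_term q t s =
  (damping t)%:C * soup_coef q (fun v => (vertex_coord t v)%:C) n.
Proof.
by rewrite -sum_level_soup mulr_sumr; apply: eq_bigr => s _; rewrite occupation_termE.
Qed.

Lemma sqrt_coordK t v : orthant t ->
  sqrt_coord t v * sqrt_coord t v = (vertex_coord t v)%:C.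
Proof. by move=> t0; rewrite -rmorphM /= -expr2 sqr_sqrtr// t0. Qed.

(** Taking norms replaces m by at most the loop measure of |q|, to which [sum_level_soup] applies as
    well. Level k is then bounded by S^k / k! with S the amplitude, since passing to |q| does not
    change the amplitude. *)
Lemma csummable_occupation_term t : orthant t -> csummable (occupation_term q t).
Proof.
move=> t0; pose S := amplitude t.
have S0 := amplitude_ge0 t.
have d0 : 0 <= damping t by rewrite mulr_ge0 ?expR_ge0// ltW.
apply: (csummable_levels (@mem_level V) (@uniq_level V) (C := damping t * expR S)) => n.
apply: le_trans (ler_wpM2l d0 (expR_partial_le n S0)).
rewrite mulr_sumr; apply: ler_sum => k _; rewrite -lecR rmorph_sum /=.
apply: (@le_trans _ _ ((damping t)%:C *
   soup_coef (abs_weight q) (fun v => (vertex_coord t v)%:C) k)).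
  rewrite -sum_level_soup mulr_sumr; apply: ler_sum => s _.
  rewrite (_ : (_)%:C = `|occupation_term q t s|); last first.
    by rewrite normc_def; case: (occupation_term q t s).
  rewrite occupation_termE normrM ger0_norm ?lecR// ler_wpM2l ?lecR// normrM.
  apply: ler_pM => //; first by apply: norm_conf_weight => l; exact: norm_loop_measure.
  rewrite normr_prod; apply: ler_prod => v _.
  by rewrite normr_ge0 ger0_norm ?lexx// divr_ge0// exprn_ge0// lecR t0.
rewrite [leRHS]rmorphM ler_wpM2l ?lecR//.
rewrite (_ : (fun v => _) = fun v => sqrt_coord t v * sqrt_coord t v); last first.
  by apply/funext => v; rewrite sqrt_coordK.
apply: le_trans (real_ler_norm _) _.
  apply: ger0_real; rewrite mulr_ge0 ?invr_ge0//; apply: sumr_ge0 => a _.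
  rewrite mulr_ge0//; last by apply: prodr_ge0 => v _; rewrite sqrt_coordK// lecR t0.
  by apply: sumr_ge0 => b _; apply: prodr_ge0 => e _; exact: normr_ge0.
apply: (le_trans (norm_soup_coef _ _ _ _)).
rewrite rmorphM /= rmorphXn fmorphV /= rmorph_nat -sesq_norm_real.
rewrite /sesq_norm (_ : abs_weight (abs_weight q) = abs_weight q)//.
by apply/funext => u; apply/funext => v; rewrite /abs_weight normr_id.
Qed.

Hypothesis (q_hermitian : hermitian_weight q).

Lemma sesq_hermitian_real (z : V -> R[i]) :
  sesq q (fun u => (z u)^*%C) z = (complex.Re (sesq q (fun u => (z u)^*%C) z))%:C.
Proof.
suff : sesq q (fun u => (z u)^*%C) z \is Num.real by move=> /complex_realP[x ->].
apply/CrealP; rewrite /sesq rmorph_sum /= exchange_big; apply: eq_bigr => u _.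
rewrite rmorph_sum; apply: eq_bigr => v _ /=.
rewrite 2!rmorphM /= -[Num.conj _]/(_^*%C) -[Num.conj (q u v)]/((q u v)^*%C).
rewrite -(hermitian_weightE q_hermitian) -[X in _ * X]/((z v)^*%C) conjcK.
by rewrite mulrC mulrA mulrAC.
Qed.

Definition hform (z : V -> R[i]) : R := complex.Re (sesq q (fun u => (z u)^*%C) z).

Variables (t : realvec R #|V|) (z : V -> R[i]).
Hypothesis zt : forall v, (z v)^*%C * z v = (vertex_coord t v)%:C.

Lemma norm_sqrt_coord v : `|z v| = sqrt_coord t v.
Proof.
have := zt v; rewrite mulrC -sqr_normc normc_def /sqrt_coord => h.
have -> : vertex_coord t v = complex.Re (z v) ^+ 2 + complex.Im (z v) ^+ 2.
  apply: (@complexI R); rewrite -h -rmorphXn /= sqr_sqrtr//.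
  by rewrite addr_ge0 ?sqr_ge0.
by [].
Qed.

Definition rotate p (om : R[i]) (j : {ffun V -> 'I_p}) (v : V) : R[i] := z v * om ^+ j v.

(** Conjugation inverts om because |om| = 1, so the opposite phases in the two arguments come from
    rotating a single vector z. *)
Lemma sesq_rotate p om (j : {ffun V -> 'I_p}) : p.-primitive_root om ->
  sesq q (fun u => (z u)^*%C * om ^- j u) (fun v => z v * om ^+ j v) =
  (hform (rotate om j))%:C.
Proof.
move=> omP; rewrite /hform -sesq_hermitian_real; congr (sesq q _ _).
apply/funext => u; rewrite /rotate rmorphM /= rmorphXn /=; congr (_ * _).
rewrite -exprVn; congr (_ ^+ _).
have o1 := norm_unity_root omP.
by apply: (mulfI (x := om)); rewrite -?normr_gt0 ?o1 ?ltr01 ?divff -?sqr_normc ?o1 ?expr1n// -normr_gt0 o1.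
Qed.

Lemma norm_form_rotate p om (j : {ffun V -> 'I_p}) : p.-primitive_root om ->
  `|hform (rotate om j)| <= amplitude t.
Proof.
move=> omP; rewrite -lecR -sesq_norm_real.
rewrite (_ : (`|_|)%:C = `|(hform (rotate om j))%:C|); last first.
  by rewrite normc_def /= expr0n addr0 sqrtr_sqr.
rewrite -(sesq_rotate _ omP) (le_trans (norm_sesq _ _ _))//.
apply: ler_sum => u _; apply: ler_sum => v _.
rewrite !normrM normfV !normrX (norm_unity_root omP) !expr1n invr1 !mulr1.
rewrite -!norm_sqrt_coord !normr_id -[Num.norm (z u)^*%C]/(Num.norm (Num.conj (z u))).
by rewrite norm_conjC.
Qed.

(** An average of powers of the real numbers <z,Qz> is real. One prime above n suffices to produce
    b; as the coefficient itself involves neither p nor om, every other admissible choice gives the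
    same b. *)
Lemma soup_coef_real n : exists2 b : R,
  soup_coef q (fun v => (vertex_coord t v)%:C) n = b%:C &
  `|b| <= amplitude t ^+ n / n`!%:R /\
  forall p om, p.-primitive_root om -> (n < p)%N ->
    b = (p ^ #|V|)%:R^-1 * \sum_(j : {ffun V -> 'I_p}) (hform (rotate om j) ^+ n / n`!%:R).
Proof.
have soupE p om : p.-primitive_root om -> (n < p)%N ->
    soup_coef q (fun v => (vertex_coord t v)%:C) n = ((p ^ #|V|)%:R^-1 *
      \sum_(j : {ffun V -> 'I_p}) (hform (rotate om j) ^+ n / n`!%:R))%:C.
  move=> omP np; rewrite rmorphM fmorphV /= rmorph_nat rmorph_sum /=.
  rewrite -(funext zt) -(soup_coef_phase q _ _ omP np); congr (_ * _); apply: eq_bigr => j _.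
  by rewrite (sesq_rotate _ omP) rmorphM fmorphV /= rmorph_nat rmorphXn.
have [p np pp] := prime_above n.
have [om omP] := prime_root_of_unity R[i] pp.
exists ((p ^ #|V|)%:R^-1 * \sum_(j : {ffun V -> 'I_p}) (hform (rotate om j) ^+ n / n`!%:R)).
  exact: soupE.
split; last first.
  by move=> p' om' omP' np'; apply: (@complexI R); rewrite -!soupE.
rewrite -lecR (_ : (`|_|)%:C = `|soup_coef q (fun v => (vertex_coord t v)%:C) n|); last first.
  by rewrite (soupE _ _ omP np) normc_def /= expr0n addr0 sqrtr_sqr.
rewrite -(funext zt) (le_trans (norm_soup_coef _ _ _ _))// rmorphM fmorphV /= rmorph_nat.
rewrite rmorphXn /= /amplitude -sesq_norm_real ler_wpM2r ?invr_ge0//.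
rewrite (_ : sesq_norm q _ _ = sesq_norm q (sqrt_coord t) (sqrt_coord t))//.
rewrite /sesq_norm; congr (sesq _ _ _); apply/funext => u; rewrite -norm_sqrt_coord normr_id//.
by rewrite -[Num.norm (z u)^*%C]/(Num.norm (Num.conj (z u))) norm_conjC.
Qed.

End density.

(** Below p the terms cancel; from p on, each difference is at most twice the common majorant. *)
Lemma series_diff_bound (R : realType) (a b e : nat -> R) (A B E : R) p :
  (forall k, `|a k| <= e k) -> (forall k, `|b k| <= e k) ->
  (forall k, (k < p)%N -> a k = b k) ->
  \sum_(0 <= k < n) a k @[n --> \oo] --> A ->
  \sum_(0 <= k < n) b k @[n --> \oo] --> B ->
  \sum_(0 <= k < n) e k @[n --> \oo] --> E ->
  `|A - B| <= 2 * (E - \sum_(0 <= k < p) e k).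
Proof.
move=> ae be ab cA cB cE.
have cAB : `|\sum_(0 <= k < n) a k - \sum_(0 <= k < n) b k| @[n --> \oo] --> `|A - B|.
  by apply: cvg_norm; exact: cvgB.
have cR : 2 * (\sum_(0 <= k < n) e k - \sum_(0 <= k < p) e k) @[n --> \oo] -->
    2 * (E - \sum_(0 <= k < p) e k).
  by apply: cvgMr; apply: cvgB => //; exact: cvg_cst.
rewrite -(cvg_lim _ cAB)// -(cvg_lim _ cR)//.
apply: ler_lim; [by apply/cvg_ex; eexists; exact: cAB|by apply/cvg_ex; eexists; exact: cR|].
exists p => // n /= pn.
rewrite /= -sumrB (@big_cat_nat _ _ _ p _ n)//= (@big_cat_nat _ _ _ p 0 n)//=.
rewrite big_nat big1 ?add0r => [|k /andP[_ kp]]; last by rewrite ab// subrr.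
rewrite addrAC subrr add0r (le_trans (ler_norm_sum _ _ _))// mulr_sumr.
apply: ler_sum => k _; rewrite (le_trans (ler_normB _ _))//.
by rewrite mulr_natl mulr2n lerD.
Qed.

Section density_approximation.
Context (R : realType) (V : finType) (q : V -> V -> R[i]) (kappa : R).
Hypotheses (kappa_gt0 : 0 < kappa) (kappaE : cexp (- csum (loop_measure q)) = kappa%:C).
Hypothesis (q_hermitian : hermitian_weight q).
Variable (t : realvec R #|V|).
Hypothesis (t_ge0 : orthant t).

Let soup n := soup_coef q (fun v => (vertex_coord t v)%:C) n.

Lemma conj_sqrt_coord v : (sqrt_coord t v)^*%C * sqrt_coord t v = (vertex_coord t v)%:C.
Proof. by rewrite conjc_real; exact: sqrt_coordK. Qed.

Let soup_real n : soup n = (complex.Re (soup n))%:C.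
Proof. by have [b bE _] := soup_coef_real q_hermitian conj_sqrt_coord n; rewrite /soup bE. Qed.

Lemma cvg_occupation_density :
  damping kappa t * \sum_(0 <= k < n) complex.Re (soup k) @[n --> \oo] -->
    complex.Re (occupation_density q t) /\
  occupation_density q t = (complex.Re (occupation_density q t))%:C.
Proof.
have [cRe cIm] := csum_levels (@mem_level V) (@uniq_level V)
  (csummable_occupation_term kappa_gt0 kappaE t_ge0).
have partE n : \sum_(0 <= k < n) \sum_(s <- level V k) occupation_term q t s =
    (damping kappa t * \sum_(0 <= k < n) complex.Re (soup k))%:C.
  rewrite rmorphM rmorph_sum /= mulr_sumr; apply: eq_bigr => k _.
  by rewrite (sum_level_occupation_term kappaE) -/(soup k) {1}soup_real.
split.
  move: cRe; rewrite (_ : (fun n => _) = fun n => damping kappa t * \sum_(0 <= k < n) complex.Re (soup k))//.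
  by apply/funext => n; rewrite partE.
apply/eqP; rewrite eq_complex /= eqxx /=; apply/eqP.
apply: (@cvg_unique _ (@norm_hausdorff _ R^o)) cIm _.
rewrite (_ : (fun n => _) = cst 0); first exact: cvg_cst.
by apply/funext => n; rewrite partE.
Qed.

Lemma damping_gt0 : 0 < damping kappa t.
Proof. by rewrite mulr_gt0 ?expR_gt0. Qed.

(* At |z_v|^2 = t_v, averaging exp <z, Qz> over all independent rotations of the
   coordinates by p-th roots of unity reproduces the terms of degree < p of the
   density; both remainders are bounded by the tail of an exponential series. *)
Lemma density_phase_average (z : V -> R[i]) p om :
  (forall v, (z v)^*%C * z v = (vertex_coord t v)%:C) -> p.-primitive_root om ->
  `|damping kappa t * ((p ^ #|V|)%:R^-1 *
       \sum_(j : {ffun V -> 'I_p}) expR (hform q (rotate z om j))) -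
    complex.Re (occupation_density q t)| <=
  damping kappa t * (2 * (expR (amplitude q t) -
     \sum_(0 <= k < p) amplitude q t ^+ k / k`!%:R)).
Proof.
move=> zt omP; have [dcvg _] := cvg_occupation_density.
have d0 := damping_gt0; have dN0 : damping kappa t != 0 by rewrite gt_eqF.
have scvg : \sum_(0 <= k < n) complex.Re (soup k) @[n --> \oo] -->
    (damping kappa t)^-1 * complex.Re (occupation_density q t).
  rewrite (_ : (fun n => _) = fun n => (damping kappa t)^-1 *
     (damping kappa t * \sum_(0 <= k < n) complex.Re (soup k))).
    exact: cvgMr.
  by apply/funext => n; rewrite mulKf.
rewrite -{1}(mulVKf dN0 (complex.Re _)) -mulrBr normrM (gtr0_norm d0) ler_wpM2l ?(ltW d0)//.
have p0 : (p ^ #|V|)%:R != 0 :> R.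
  by rewrite pnatr_eq0 expn_eq0 negb_and -lt0n (prim_order_gt0 omP).
pose a k : R := (p ^ #|V|)%:R^-1 *
   \sum_(j : {ffun V -> 'I_p}) (hform q (rotate z om j) ^+ k / k`!%:R).
apply: (series_diff_bound (a := a) (b := fun k => complex.Re (soup k))
   (e := fun k => amplitude q t ^+ k / k`!%:R)) scvg _.
- move=> k; rewrite /a normrM normfV normr_nat ler_pdivrMl ?lt0r ?p0 ?ler0n//.
  apply: (@le_trans _ _ (\sum_(j : {ffun V -> 'I_p}) amplitude q t ^+ k / k`!%:R)); last first.
    by rewrite sumr_const card_ffun card_ord mulr_natl.
  rewrite (le_trans (ler_norm_sum _ _ _))//; apply: ler_sum => j _.
  rewrite normrM normfV normr_nat ler_wpM2r ?invr_ge0// normrX.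
  by apply: lerXn2r; rewrite ?nnegrE ?amplitude_ge0// norm_form_rotate.
- by move=> k; rewrite /soup; have [b -> []] := soup_coef_real q_hermitian zt k.
- move=> k kp; rewrite /soup; have [b -> [_ bE]] := soup_coef_real q_hermitian zt k.
  by rewrite /= (bE p om).
- rewrite (_ : (fun n => _) = fun n => (p ^ #|V|)%:R^-1 * \sum_(j : {ffun V -> 'I_p})
     \sum_(0 <= k < n) hform q (rotate z om j) ^+ k / k`!%:R).
    by apply: cvgMr; apply: cvgn_sum => j; exact: expR_series.
  by apply/funext => n; rewrite /a -mulr_sumr exchange_big.
- exact: expR_series.
Qed.

End density_approximation.

(** * Rotations and radial functions on C^N *)

Section line_changes.
Context (R : realType).
Local Notation mu := (@lebesgue_measure R).
Local Notation T := (measurableTypeR R).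
Local Open Scope ereal_scope.

Lemma measurable_shiftR (a : R) : measurable_fun [set: T] (fun x : T => (x + a)%R : T).
Proof. by apply: measurable_funD => //; exact: measurable_id. Qed.

Lemma measurable_scaleR (s : R) : measurable_fun [set: T] (fun x : T => (s * x)%R : T).
Proof. by apply: measurable_funM => //; exact: measurable_id. Qed.

(** The pushforward of Lebesgue measure under a translation agrees with it on half-open intervals,
    hence everywhere by uniqueness. Scaling below is treated in the same way. *)
Lemma ge0_integral_shiftR (a : R) (f : T -> \bar R) :
  measurable_fun [set: T] f -> (forall x, 0 <= f x) ->
  \int[mu]_x f (x + a)%R = \int[mu]_x f x.
Proof.
move=> mf f0; have mphi := measurable_shiftR a.
rewrite -[LHS](@ge0_integral_pushforward _ _ T T R _ mphi mu setT f)//.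
apply: eq_measure_integral => //= A mA _; apply/esym.
apply: (lebesgue_measure_unique (mu := pushforward mu _)) => //= _ [[b c]] _ <-.
rewrite /pushforward /= (_ : _ @^-1` _ = `](b - a)%R, (c - a)%R]%classic); last first.
  by apply/seteqP; split=> x /=; rewrite !in_itv/= => /andP[h1 h2]; apply/andP; split; lra.
rewrite !lebesgue_measure_itv /= !lte_fin ltrD2r.
by rewrite -!EFinB; case: ifP => // _; congr _%:E; ring.
Qed.

Lemma ge0_integral_scaleR (s : R) (f : T -> \bar R) : (0 < s)%R ->
  measurable_fun [set: T] f -> (forall x, 0 <= f x) ->
  s%:E * \int[mu]_x f (s * x)%R = \int[mu]_x f x.
Proof.
move=> s0 mf f0; have mphi := measurable_scaleR s.
rewrite -[X in _ * X](@ge0_integral_pushforward _ _ T T R _ mphi mu setT f)//.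
pose sn := NngNum (ltW s0).
rewrite -[LHS](ge0_integral_mscale (pushforward mu _) measurableT sn)//.
apply: eq_measure_integral => //= A mA _; apply/esym.
apply: (lebesgue_measure_unique (mu := mscale sn (pushforward mu _))) => //= _ [[b c]] _ <-.
rewrite /mscale /= /pushforward /= (_ : _ @^-1` _ = `](b / s)%R, (c / s)%R]%classic); last first.
  apply/seteqP; split=> x /=; rewrite !in_itv/= => /andP[h1 h2]; apply/andP; split.
  - by rewrite ltr_pdivrMr// mulrC.
  - by rewrite ler_pdivlMr// mulrC.
  - by move: h1; rewrite ltr_pdivrMr// mulrC.
  - by move: h2; rewrite ler_pdivlMr// mulrC.
rewrite !lebesgue_measure_itv /= !lte_fin ltr_pM2r ?invr_gt0//.
rewrite -!EFinB; case: ifP => _; last by rewrite mule0.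
by rewrite -EFinM -mulrBl mulrCA divff ?mulr1// gt_eqF.
Qed.

End line_changes.

Section plane_changes.
Context (R : realType).
Local Notation mu := (@lebesgue_measure R).
Local Notation T := (measurableTypeR R).
Local Open Scope ereal_scope.

Let measurable_shear1 (a : R) :
  measurable_fun [set: T * T] (fun p : T * T => ((p.1 + a * p.2)%R : T, p.2)).
Proof.
apply/measurable_fun_pair => /=; last exact: measurable_snd.
apply: measurable_funD; first exact: measurable_fst.
by apply: measurable_funM => //; exact: measurable_snd.
Qed.

Let measurable_shear2 (a : R) :
  measurable_fun [set: T * T] (fun p : T * T => (p.1, (p.2 + a * p.1)%R : T)).
Proof.
apply/measurable_fun_pair => /=; first exact: measurable_fst.
apply: measurable_funD; first exact: measurable_snd.
by apply: measurable_funM => //; exact: measurable_fst.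
Qed.

Let integral_shear1 (a : R) (f : T * T -> \bar R) :
  measurable_fun [set: T * T] f -> (forall p, 0 <= f p) ->
  \int[mu \x mu]_p f ((p.1 + a * p.2)%R, p.2) = \int[mu \x mu]_p f p.
Proof.
move=> mf f0; rewrite !fubini_tonelli2//; last first.
  exact: (measurableT_comp mf (measurable_shear1 a)).
apply: eq_integral => y _; rewrite /fubini_G /=.
apply: (@ge0_integral_shiftR R (a * y) (fun x => f (x, y))) => //.
exact: measurableT_comp.
Qed.

Let integral_shear2 (a : R) (f : T * T -> \bar R) :
  measurable_fun [set: T * T] f -> (forall p, 0 <= f p) ->
  \int[mu \x mu]_p f (p.1, (p.2 + a * p.1)%R) = \int[mu \x mu]_p f p.
Proof.
move=> mf f0; rewrite !fubini_tonelli1//; last first.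
  exact: (measurableT_comp mf (measurable_shear2 a)).
apply: eq_integral => x _; rewrite /fubini_F /=.
apply: (@ge0_integral_shiftR R (a * x) (fun y => f (x, y))) => //.
exact: measurableT_comp.
Qed.

Definition plane_rotation (c s : R) (p : T * T) : T * T :=
  ((c * p.1 - s * p.2)%R, (s * p.1 + c * p.2)%R).

(* A rotation by an angle other than pi is a product of three shears. *)
Lemma integral_plane_rotation (c s : R) (f : T * T -> \bar R) :
  (c ^+ 2 + s ^+ 2 = 1)%R -> c != (- 1)%R ->
  measurable_fun [set: T * T] f -> (forall p, 0 <= f p) ->
  \int[mu \x mu]_p f (plane_rotation c s p) = \int[mu \x mu]_p f p.
Proof.
(* For c = cos theta and s = sin theta this is a = - tan (theta / 2), which has no value at theta =
   pi. *)
move=> cs c1 mf f0; pose a := (- s / (1 + c))%R.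
have c10 : (1 + c != 0)%R by rewrite addrC addr_eq0.
have mf1 := measurableT_comp mf (measurable_shear1 a).
have mf2 := measurableT_comp mf1 (measurable_shear2 s).
have s2 : (s ^+ 2 = (1 - c) * (1 + c))%R by rewrite -(addKr (c ^+ 2) (s ^+ 2))%R cs; ring.
have ss : (1 + a * s = c)%R.
  by apply: (mulIf c10); rewrite mulrDl mulrAC /a divfK// mulNr -expr2 s2; ring.
have a1 : (a * (1 + c) = - s)%R by rewrite /a divfK.
transitivity (\int[mu \x mu]_p (f \o (fun p : T * T => ((p.1 + a * p.2)%R : T, p.2)) \o
   (fun p : T * T => (p.1, (p.2 + s * p.1)%R : T))) ((p.1 + a * p.2)%R, p.2)).
  apply: eq_integral => -[x y] _ /=; rewrite /plane_rotation /=; congr (f (_, _)).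
    transitivity ((1 + a * s) * x + a * (1 + (1 + a * s)) * y)%R; last by ring.
    by rewrite ss a1; ring.
  by transitivity (s * x + (1 + a * s) * y)%R; [rewrite ss|ring].
exact: (etrans (integral_shear1 a mf2 (fun=> f0 _))
  (etrans (integral_shear2 s mf1 (fun=> f0 _)) (integral_shear1 a mf f0))).
Qed.

Let measurable_scale2 (s : R) :
  measurable_fun [set: T * T] (fun p : T * T => ((s * p.1)%R : T, (s * p.2)%R : T)).
Proof.
by apply/measurable_fun_pair => /=; apply: measurable_funM.
Qed.

Lemma integral_plane_scaling (s : R) (f : T * T -> \bar R) : (0 < s)%R ->
  measurable_fun [set: T * T] f -> (forall p, 0 <= f p) ->
  (s ^+ 2)%:E * \int[mu \x mu]_p f ((s * p.1)%R, (s * p.2)%R) = \int[mu \x mu]_p f p.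
Proof.
move=> s0 mf f0; have ms := measurableT_comp mf (measurable_scale2 s).
rewrite fubini_tonelli1// [RHS]fubini_tonelli1//.
have mF : measurable_fun [set: T] (fubini_F mu f).
  exact: measurable_fun_fubini_tonelli_F.
rewrite -(ge0_integral_scaleR s0 mF); last by move=> x; apply: integral_ge0.
rewrite expr2 EFinM -muleA; congr (_ * _).
have mG : measurable_fun [set: T] (fun x : T => \int[mu]_y f ((s * x)%R, (s * y)%R)).
  by apply: (measurable_fun_fubini_tonelli_F (m2 := mu) _ ms) => p; exact: f0.
rewrite -ge0_integralZl//; first last.
- by rewrite lee_fin ltW.
- by move=> x _; apply: integral_ge0.
apply: eq_integral => x _; rewrite /fubini_F /=.
apply: (@ge0_integral_scaleR R s (fun y => f ((s * x)%R, y)) s0) => //.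
exact: measurableT_comp.
Qed.

End plane_changes.

Section radial_integral.
Context (R : realType).
Local Notation mu := (@lebesgue_measure R).
Local Notation T := (measurableTypeR R).
Local Open Scope ereal_scope.

Definition sqnorm2 (p : T * T) : T := (p.1 ^+ 2 + p.2 ^+ 2)%R.

Lemma measurable_sqnorm2 : measurable_fun [set: T * T] sqnorm2.
Proof. by apply: measurable_funD; apply: measurable_funX. Qed.

Lemma sqnorm2_ge0 p : (0 <= sqnorm2 p)%R.
Proof. by rewrite addr_ge0 ?sqr_ge0. Qed.

Let disc (r : R) : set (T * T) := [set p | (sqnorm2 p < r)%R].

Let measurable_disc r : measurable (disc r).
Proof.
rewrite (_ : disc r = sqnorm2 @^-1` `]-oo, r[).
  by rewrite -[X in measurable X]setTI; apply: measurable_sqnorm2.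
by apply/seteqP; split=> p /=; rewrite in_itv.
Qed.

Let area (r : R) : \bar R := (mu \x mu) (disc r).

Let area_scale (r : R) : (0 < r)%R -> area r = r%:E * area 1.
Proof.
move=> r0; have s0 : (0 < Num.sqrt r)%R by rewrite sqrtr_gt0.
have ind (s : R) : area s = \int[mu \x mu]_p (\1_(disc s) p)%:E.
  by rewrite integral_indic// setIT.
rewrite !ind -(integral_plane_scaling s0 (f := fun p => (\1_(disc r) p)%:E)).
- rewrite sqr_sqrtr ?ltW//; congr (_ * _); apply: eq_integral => p _.
  rewrite !indicE; congr ((nat_of_bool _)%:R%:E); apply/idP/idP; rewrite !inE /disc /sqnorm2 /=.
    by rewrite !exprMn sqr_sqrtr ?ltW// -mulrDr gtr_pMr.
  by rewrite !exprMn sqr_sqrtr ?ltW// -mulrDr gtr_pMr.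
- by apply/measurable_EFinP; exact: measurable_indic.
- by move=> p; rewrite lee_fin.
Qed.

Let area1_fin : area 1 < +oo.
Proof.
apply: (@le_lt_trans _ _ ((mu \x mu) (`[(-1)%R, 1%R] `*` `[(-1)%R, 1%R]))).
  apply: le_measure; rewrite ?inE//; first by apply: measurableX.
  move=> [x y] /=; rewrite /disc /sqnorm2 /= => xy; rewrite !in_itv /= -!ler_norml.
  split; rewrite -(@ler_pXn2r _ 2) ?nnegrE// real_normK ?num_real// expr1n.
    by rewrite (le_trans _ (ltW xy))// lerDl sqr_ge0.
  by rewrite (le_trans _ (ltW xy))// lerDr sqr_ge0.
by rewrite product_measure1E//= !lebesgue_measure_itv /= lte_fin ifT ?ltry//; lra.
Qed.

Let C : R := fine (area 1).

Let C0 : (0 <= C)%R. Proof. by rewrite fine_ge0. Qed.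

Let CE : C%:E = area 1. Proof. by rewrite fineK// ge0_fin_numE. Qed.

(** The half-lines ]-oo, r[ are stable under intersection, generate the Borel sets and exhaust the
    line with finite measure, so the two measures need only be compared on them, which is the area
    of a disc. *)
Let measure_sqnorm2 (A : set T) : measurable A ->
  pushforward (mu \x mu) sqnorm2 A = C%:E * mu (A `&` `[0%R, +oo[).
Proof.
move=> mA; pose Cn := NngNum C0.
have mD : measurable (`[0%R, +oo[%classic : set T) by [].
rewrite -[RHS]/(mscale Cn (mrestr mu mD) A).
pose g n : set T := `]-oo, n.+1%:R[%classic.
apply: (@measure_unique _ R T (@RGenInftyO.G R) g) mA.
- exact: RGenInftyO.measurableE.
- move=> _ _ [x ->] [y ->]; exists (Num.min x y).
  by apply/seteqP; split=> z /=; rewrite !in_itv /= lt_min => /andP.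
- by move=> n; exists n.+1%:R.
- apply/seteqP; split=> // x _; exists (Num.trunc `|x|)%N => //=.
  rewrite /g /= in_itv /=.
  exact: le_lt_trans (ler_norm _) (truncnS_gt _).
- exact: measurable_sqnorm2.
- move=> mm _ [r ->]; rewrite -[RHS]/(C%:E * mu (`]-oo, r[ `&` `[0%R, +oo[)).
  rewrite -[LHS]/((mu \x mu) (sqnorm2 @^-1` `]-oo, r[)).
  rewrite (_ : sqnorm2 @^-1` _ = disc r); last first.
    by apply/seteqP; split=> p /=; rewrite in_itv.
  rewrite -/(area r); have [r0|r0] := leP r 0%R.
    rewrite /area (_ : disc r = set0); last first.
      apply/seteqP; split=> // p; rewrite /disc /= => pr.
      by have := lt_le_trans pr r0; rewrite ltNge sqnorm2_ge0.
    rewrite measure0 (_ : _ `&` _ = set0) ?measure0 ?mule0//.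
    apply/seteqP; split=> // x /=; rewrite !in_itv /= andbT => -[xr x0].
    by have := le_lt_trans x0 (lt_le_trans xr r0); rewrite ltxx.
  rewrite area_scale// CE muleC; congr (_ * _).
  rewrite (_ : _ `&` _ = `[0%R, r[%classic); last first.
    by apply/seteqP; split=> x /=; rewrite !in_itv /= andbT; [case=> -> ->|case/andP=> -> ->].
  by rewrite lebesgue_measure_itv /= lte_fin r0 sube0.
- move=> mm n; rewrite -[X in X < _]/((mu \x mu) (sqnorm2 @^-1` `]-oo, n.+1%:R[)) (_ : sqnorm2 @^-1` _ = disc n.+1%:R); last first.
    by apply/seteqP; split=> p /=; rewrite in_itv.
  by rewrite -/(area _) area_scale// -CE -EFinM ltry.
Qed.

Let radialC (h : T -> \bar R) : measurable_fun [set: T] h -> (forall x, 0 <= h x) ->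
  \int[mu \x mu]_p h (sqnorm2 p) = C%:E * \int[mu]_(r in `[0%R, +oo[) h r.
Proof.
move=> mh h0; pose Cn := NngNum C0.
have mD : measurable (`[0%R, +oo[%classic : set T) by [].
have preD : sqnorm2 @^-1` `[0%R, +oo[ = setT.
  by apply/seteqP; split=> // p _ /=; rewrite in_itv /= andbT sqnorm2_ge0.
have E := @ge0_integral_pushforward _ _ _ T R _ measurable_sqnorm2 (mu \x mu) _ h mD
  (measurable_funTS mh) (fun y _ => h0 y).
rewrite preD in E; apply: (etrans (esym E)).
apply: (etrans _ (ge0_integral_mscale mu mD Cn _ _)) => //; last exact: measurable_funTS.
apply: eq_measure_integral; first exact: measurable_sqnorm2.
by move=> mm A mA AD; have := measure_sqnorm2 mA; rewrite setIidl.
Qed.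

Let C_pi : C = pi.
Proof.
have mexp : measurable_fun [set: T] (fun r : T => (expR (- r))%:E).
  apply/measurable_EFinP; apply: measurableT_comp; first exact: measurable_expR.
  by apply: measurable_funN; exact: measurable_id.
have exp1 : \int[mu]_(r in `[0%R, +oo[) (expR (- r))%:E = 1.
  rewrite -(integral_exponential_pdf (@ltr01 R)) integral_mkcond.
  apply: eq_integral => r _; rewrite /exponential_pdf !patchE; case: ifP => // _.
  by rewrite mul1r mulN1r.
apply/eqP; rewrite -eqe; apply/eqP.
have exp_ge0 (r : T) : 0 <= (expR (- r))%:E by rewrite lee_fin expR_ge0.
rewrite -[LHS]mule1 -exp1 -(radialC mexp exp_ge0).
have msq := measurableT_comp mexp measurable_sqnorm2.
rewrite (fubini_tonelli1 _ msq); last by move=> p; exact: exp_ge0.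
have gaussE x : fubini_F mu ((fun r : T => (expR (- r))%:E) \o sqnorm2) x =
    (gauss_fun x)%:E * (Num.sqrt pi)%:E.
  rewrite -integralT_gauss -ge0_integralZl//.
  - by apply: eq_integral => y _; rewrite /= /sqnorm2 /= opprD expRD EFinM.
  - by apply/measurable_EFinP; exact: measurable_gauss_fun.
  - by move=> y _; rewrite lee_fin gauss_fun_ge0.
  - by rewrite lee_fin gauss_fun_ge0.
under eq_integral do rewrite gaussE muleC.
rewrite ge0_integralZl//.
- by rewrite integralT_gauss -EFinM -expr2 sqr_sqrtr// pi_ge0.
- by apply/measurable_EFinP; exact: measurable_gauss_fun.
- by move=> y _; rewrite lee_fin gauss_fun_ge0.
Qed.

(* By scaling, discs about the origin have area proportional to the square of the
   radius, so |z|^2 maps Lebesgue measure to a multiple of Lebesgue measure on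
   [0, +oo); the Gaussian integral gives the multiple pi. *)
Lemma radial_integral (h : T -> \bar R) :
  measurable_fun [set: T] h -> (forall x, 0 <= h x) ->
  \int[mu \x mu]_p h (sqnorm2 p) = pi%:E * \int[mu]_(r in `[0%R, +oo[) h r.
Proof. by move=> mh h0; rewrite radialC// C_pi. Qed.

End radial_integral.

(* The library declares this instance for the constant [product_measure1] but a
   later one, for subprobabilities, shadows it. *)
Section sigma_finite_product.
Context d1 d2 (T1 : measurableType d1) (T2 : measurableType d2) (R : realType).
Context (m1 : {sigma_finite_measure set T1 -> \bar R}).
Context (m2 : {sigma_finite_measure set T2 -> \bar R}).

Definition sigma_finite_product : set (T1 * T2) -> \bar R := (m1 \x m2)%E.

HB.instance Definition _ := Measure.copy sigma_finite_product (m1 \x m2)%E.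

Let sigma_finite_productP : sigma_finite setT sigma_finite_product.
Proof.
have /sigma_finiteP[F [FT ndF Foo]] := sigma_finiteT m1.
have /sigma_finiteP[G [GT ndG Goo]] := sigma_finiteT m2.
exists (fun n => F n `*` G n).
  rewrite -setXTT FT GT predeqE => -[x y]; split.
    move=> [/= [n _ Fnx] [k _ Gky]]; exists (maxn n k) => //; split.
    - by move: x Fnx; exact/subsetPset/ndF/leq_maxl.
    - by move: y Gky; exact/subsetPset/ndG/leq_maxr.
  by move=> [n _ []/= ? ?]; split; exists n.
move=> k; have [? ?] := Foo k; have [? ?] := Goo k.
split; first exact: measurableX.
by rewrite /sigma_finite_product product_measure1E// lte_mul_pinfty// ge0_fin_numE.
Qed.

HB.instance Definition _ := @Measure_isSigmaFinite.Build _ _ _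
  sigma_finite_product sigma_finite_productP.

End sigma_finite_product.

(** * Integration over C^N one complex coordinate at a time *)

Section integration_by_planes.
Context (R : realType).
Local Notation mu := (@lebesgue_measure R).
Local Notation T := (measurableTypeR R).
Local Notation L N := (lebesgue_vec R N).
Local Open Scope ereal_scope.

Local Notation L2 N := (sigma_finite_product (L N) (L N)).

Lemma integral_lebesgue_vecS N (f : realvec R N.+1 -> \bar R) :
  measurable_fun [set: realvec R N.+1] f -> (forall t, 0 <= f t) ->
  \int[L N.+1]_t f t = \int[mu]_x \int[L N]_t f (consvec (x, t)).
Proof.
move=> mf f0; have mc := @measurable_consvec R N.
have E := @ge0_integral_pushforward _ _ _ _ R _ mc (mu \x L N) setT f measurableT mf (fun y _ => f0 y).
apply: (etrans E); rewrite preimage_setT.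
by rewrite (fubini_tonelli1 _ (measurableT_comp mf mc)) => // p; exact: f0.
Qed.

Definition consplane N (z : (T * T) * (realvec R N * realvec R N)) :
    realvec R N.+1 * realvec R N.+1 :=
  (consvec (z.1.1, z.2.1), consvec (z.1.2, z.2.2)).

Lemma measurable_consplane N : measurable_fun setT (@consplane N).
Proof.
by apply/measurable_fun_pair; apply: measurableT_comp (@measurable_consvec R N) _;
  apply/measurable_fun_pair; apply: measurableT_comp.
Qed.

Lemma measurable_integral_planes N (f : realvec R N.+1 * realvec R N.+1 -> \bar R) :
  measurable_fun setT f -> (forall z, 0 <= f z) ->
  measurable_fun setT (fun p : T * T => \int[L N \x L N]_w f (consplane (p, w))).
Proof.
move=> mf f0; have mfc := measurableT_comp mf (@measurable_consplane N).
have f0' z : 0 <= (f \o @consplane N) z by exact: f0.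
exact: (measurable_fun_fubini_tonelli_F (m2 := L2 N) _ mfc f0').
Qed.

(** C^(N+1) is stored as real parts followed by imaginary parts. Tonelli regroups the first real
    with the first imaginary coordinate, so that results about the plane can be applied coordinate
    by coordinate. *)
Lemma integral_planes N (f : realvec R N.+1 * realvec R N.+1 -> \bar R) :
  measurable_fun setT f -> (forall z, 0 <= f z) ->
  \int[L N.+1 \x L N.+1]_z f z =
  \int[mu \x mu]_p \int[L N \x L N]_w f (consplane (p, w)).
Proof.
move=> mf f0; have mfc := measurableT_comp mf (@measurable_consplane N).
have mc := @measurable_consvec R N.
have mI := measurable_integral_planes mf f0.
have I0 p : 0 <= \int[L N \x L N]_w f (consplane (p, w)) by apply: integral_ge0.
rewrite (fubini_tonelli1 f mf f0) (fubini_tonelli1 _ mI I0).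
rewrite integral_lebesgue_vecS; first last.
- by move=> X; apply: integral_ge0.
- exact: measurable_fun_fubini_tonelli_F.
apply: eq_integral => x _; rewrite /fubini_F.
have mfx (X : realvec R N) : measurable_fun setT (fun Y => f (consvec (x, X), Y)).
  exact: measurableT_comp.
have mperm (y : T) : measurable_fun setT
    (fun w : realvec R N * realvec R N => f (consplane ((x, y), w))).
  by apply: (measurableT_comp mfc); apply/measurable_fun_pair.
(* With x fixed and the remaining imaginary parts integrated out, what is left is to exchange the
   remaining real parts X with the first imaginary part y. *)
pose g (z : realvec R N * T) := \int[L N]_Y f (consplane ((x, z.2), (z.1, Y))).
have mg : measurable_fun setT g.
  have mg' : measurable_fun setT (fun z : (realvec R N * T) * realvec R N =>
      f (consplane ((x, z.1.2), (z.1.1, z.2)))).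
    apply: (measurableT_comp mfc); apply/measurable_fun_pair; apply/measurable_fun_pair => //.
    + exact: measurableT_comp.
    + exact: measurableT_comp.
  by apply: (measurable_fun_fubini_tonelli_F (m2 := L N) _ mg') => z; exact: f0.
have g0 z : 0 <= g z by apply: integral_ge0.
transitivity (\int[L N]_X \int[mu]_y g (X, y)).
  by apply: eq_integral => X _; exact: integral_lebesgue_vecS.
rewrite -[LHS](fubini_tonelli1 g mg g0) (fubini_tonelli2 g mg g0).
apply: eq_integral => y _; rewrite /fubini_G /g /=.
by rewrite (fubini_tonelli1 _ (mperm y)).
Qed.

End integration_by_planes.

Section complex_vectors.
Context (R : realType).
Local Notation mu := (@lebesgue_measure R).
Local Notation T := (measurableTypeR R).
Local Notation L N := (lebesgue_vec R N).
Local Open Scope ereal_scope.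

Lemma vcoord_consvec0 N (x : T) (t : realvec R N) : vcoord (consvec (x, t)) ord0 = x.
Proof. by rewrite /vcoord (tnth_nth x). Qed.

Lemma vcoord_consvecS N (x : T) (t : realvec R N) i :
  vcoord (consvec (x, t)) (lift ord0 i) = vcoord t i.
Proof. by rewrite /vcoord !(tnth_nth x). Qed.

Lemma measurable_vcoord N (i : 'I_N) :
  measurable_fun [set: realvec R N] (fun t => vcoord t i : T).
Proof. exact: measurable_tnth. Qed.

Lemma measurable_mktuple d (X : measurableType d) N (f : 'I_N -> X -> T) :
  (forall i, measurable_fun setT (f i)) ->
  measurable_fun setT (fun x => [tuple f i x | i < N] : realvec R N).
Proof.
move=> mf; apply/measurable_fun_tnthP => i.
rewrite (_ : _ \o _ = f i); first exact: mf.
by apply/funext => x /=; rewrite tnth_mktuple.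
Qed.

Definition cvec_rotation N (c s : 'I_N -> R) (z : realvec R N * realvec R N) :
    realvec R N * realvec R N :=
  ([tuple (c i * vcoord z.1 i - s i * vcoord z.2 i)%R : T | i < N],
   [tuple (s i * vcoord z.1 i + c i * vcoord z.2 i)%R : T | i < N]).

Definition cvec_sqnorm N (z : realvec R N * realvec R N) : realvec R N :=
  [tuple sqnorm2 (vcoord z.1 i, vcoord z.2 i) | i < N].

Let measurable_coord1 N (i : 'I_N) :
  measurable_fun setT (fun z : realvec R N * realvec R N => vcoord z.1 i : T).
Proof. exact: (measurableT_comp (measurable_vcoord i)). Qed.

Let measurable_coord2 N (i : 'I_N) :
  measurable_fun setT (fun z : realvec R N * realvec R N => vcoord z.2 i : T).
Proof. exact: (measurableT_comp (measurable_vcoord i)). Qed.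

Lemma measurable_cvec_rotation N c s : measurable_fun setT (@cvec_rotation N c s).
Proof.
apply/measurable_fun_pair; apply: measurable_mktuple => i.
  by apply: measurable_funB; apply: measurable_funM => //; first [exact: measurable_coord1|exact: measurable_coord2].
by apply: measurable_funD; apply: measurable_funM => //; first [exact: measurable_coord1|exact: measurable_coord2].
Qed.

Lemma measurable_cvec_sqnorm N : measurable_fun setT (@cvec_sqnorm N).
Proof.
apply: measurable_mktuple => i; apply: (measurableT_comp (@measurable_sqnorm2 R)).
by apply/measurable_fun_pair; [exact: measurable_coord1|exact: measurable_coord2].
Qed.

Lemma cvec_rotation_consplane N (c s : 'I_N.+1 -> R) p w :
  cvec_rotation c s (consplane (p, w)) =
  consplane (plane_rotation (c ord0) (s ord0) p,
    cvec_rotation (fun i => c (lift ord0 i)) (fun i => s (lift ord0 i)) w).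
Proof.
congr (_, _); apply: eq_from_tnth => i; rewrite tnth_mktuple -[RHS]/(vcoord (consvec _) i);
  case: (unliftP ord0 i) => [j|] ->;
  by rewrite !(vcoord_consvec0, vcoord_consvecS)// /vcoord /= tnth_mktuple.
Qed.

Lemma cvec_sqnorm_consplane N p (w : realvec R N * realvec R N) :
  cvec_sqnorm (consplane (p, w)) = consvec (sqnorm2 p, cvec_sqnorm w).
Proof.
apply: eq_from_tnth => i; rewrite tnth_mktuple -[RHS]/(vcoord (consvec _) i).
case: (unliftP ord0 i) => [j|] ->; rewrite !(vcoord_consvec0, vcoord_consvecS)//.
by rewrite /vcoord /= tnth_mktuple.
Qed.

Lemma integral_cvec_rotation N (c s : 'I_N -> R) (f : realvec R N * realvec R N -> \bar R) :
  (forall i, c i ^+ 2 + s i ^+ 2 = 1)%R -> (forall i, c i != (- 1)%R) ->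
  measurable_fun setT f -> (forall z, 0 <= f z) ->
  \int[L N \x L N]_z f (cvec_rotation c s z) = \int[L N \x L N]_z f z.
Proof.
elim: N c s f => [|N IHN] c s f cs c1 mf f0.
  by apply: eq_integral => -[x y] _; congr (f (_, _)); apply: eq_from_tnth => -[].
have mfr := measurableT_comp mf (measurable_cvec_rotation c s).
rewrite (integral_planes mfr (fun z => f0 _)) (integral_planes mf f0).
have mI := measurable_integral_planes mf f0.
have I0 p : 0 <= \int[L N \x L N]_w f (consplane (p, w)) by apply: integral_ge0.
have mfc := measurableT_comp mf (@measurable_consplane R N).
rewrite -(integral_plane_rotation (cs ord0) (c1 ord0) mI I0); apply: eq_integral => p _.
have mfp : measurable_fun setT (fun w => f (consplane (plane_rotation (c ord0) (s ord0) p, w))).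
  by apply: (measurableT_comp mfc); apply/measurable_fun_pair.
have E := IHN (fun i => c (lift ord0 i)) (fun i => s (lift ord0 i)) _
  (fun i => cs _) (fun i => c1 _) mfp (fun=> f0 _).
apply: (etrans _ E).
by apply: eq_integral => w _; rewrite /= cvec_rotation_consplane.
Qed.

(** [orthant] is tied to the dimension #|V|; the induction on the dimension needs every N. *)
Definition orthantN N : set (realvec R N) := [set t | forall i, (0 <= vcoord t i)%R].
Arguments orthantN : clear implicits.

Lemma measurable_orthantN N : measurable (orthantN N).
Proof.
rewrite (_ : orthantN N = \bigcap_(i in [set: 'I_N]) ((fun t => vcoord t i : T) @^-1` `[0%R, +oo[)).
  apply: fin_bigcap_measurable => // i _.
  by rewrite -[X in measurable X]setTI; exact: measurable_vcoord.
apply/seteqP; split=> t /= t0 i => [_|]; first by rewrite /= in_itv /= t0.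
by have := t0 i Logic.I; rewrite /= in_itv /= andbT.
Qed.

(** Each complex coordinate contributes one radial integral, hence one factor pi and one half-line.
    In dimension 0 both measures are point masses. *)
Lemma integral_cvec_sqnorm N (h : realvec R N -> \bar R) :
  measurable_fun setT h -> (forall t, 0 <= h t) ->
  \int[L N \x L N]_z h (cvec_sqnorm z) = (pi ^+ N)%:E * \int[L N]_(t in orthantN N) h t.
Proof.
elim: N h => [|N IHN] h mh h0.
  rewrite expr0 mul1e (_ : orthantN 0 = setT); last first.
    by apply/seteqP; split=> // t _ [].
  rewrite fubini_tonelli1//; last exact: (measurableT_comp mh (@measurable_cvec_sqnorm 0)).
  have E (t : realvec R 0) : t = [tuple] by apply: eq_from_tnth => -[].
  have D (f : realvec R 0 -> \bar R) : \int[L 0]_t f t = f [tuple].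
    rewrite (_ : f = cst (f [tuple])); last by apply/funext => t; rewrite (E t).
    by rewrite -[LHS]/(\int[\d_([tuple] : realvec R 0)]_t _) integral_dirac// diracT mul1e.
  by rewrite !D /fubini_F D (E (cvec_sqnorm _)).
have mhs := measurableT_comp mh (@measurable_cvec_sqnorm N.+1).
have mhc := measurableT_comp mh (@measurable_consvec R N).
rewrite (integral_planes mhs (fun z => h0 _)).
pose H r := \int[L N]_(t in orthantN N) h (consvec (r, t)).
have mH : measurable_fun setT H.
  (* Extension by 0 off the orthant turns H into an ordinary marginal, whose measurability is part
     of Tonelli's theorem. *)
  pose hc := (h \o @consvec R N) \_ (setT `*` orthantN N).
  have mhc' : measurable_fun setT hc.
    apply/(measurable_restrictT _ _).1; last exact: measurable_funTS.
    by apply: measurableX => //; exact: measurable_orthantN.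
  have hc0 z : 0 <= hc z by rewrite /hc patchE; case: ifP => // _; exact: h0.
  have -> : H = fubini_F (L N) hc.
    apply/funext => r; rewrite /H integral_mkcond; apply: eq_integral => t _.
    by rewrite /hc !patchE in_setX in_setT.
  exact: measurable_fun_fubini_tonelli_F.
have H0 r : 0 <= H r by apply: integral_ge0.
transitivity (\int[mu \x mu]_p ((pi ^+ N)%:E * H (sqnorm2 p))).
  apply: eq_integral => p _ /=.
  have mhp : measurable_fun setT (fun t => h (consvec (sqnorm2 p, t))).
    by apply: (measurableT_comp mhc); apply/measurable_fun_pair.
  apply: (etrans _ (IHN _ mhp (fun=> h0 _))).
  by apply: eq_integral => w _; rewrite cvec_sqnorm_consplane.
rewrite ge0_integralZl//; first last.
- by rewrite lee_fin exprn_ge0// pi_ge0.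
- exact: (measurableT_comp mH (@measurable_sqnorm2 R)).
rewrite (radial_integral mH H0) muleA -EFinM -exprSr; congr (_ * _).
have mhr : measurable_fun setT (h \_ (orthantN N.+1)).
  apply/(measurable_restrictT _ _).1; last exact: measurable_funTS.
  exact: measurable_orthantN.
have hr0 t : 0 <= (h \_ (orthantN N.+1)) t by rewrite patchE; case: ifP => // _; exact: h0.
rewrite [RHS]integral_mkcond (integral_lebesgue_vecS mhr hr0).
rewrite integral_mkcond; apply: eq_integral => r _; rewrite patchE /H integral_mkcond.
case: ifPn => [|r0].
  rewrite inE /= in_itv /= andbT => r0; apply: eq_integral => t _; rewrite !patchE.
  have -> : (consvec (r, t) \in orthantN N.+1) = (t \in orthantN N).
    apply/idP/idP; rewrite !inE => t0 i; first by have := t0 (lift ord0 i); rewrite vcoord_consvecS.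
    by case: (unliftP ord0 i) => [j|] ->; rewrite !(vcoord_consvec0, vcoord_consvecS).
  by [].
rewrite integral0_eq// => t _; rewrite patchE ifN//; apply: contra r0; rewrite !inE => t0.
by have := t0 ord0; rewrite vcoord_consvec0 /= in_itv /= andbT.
Qed.

End complex_vectors.
Arguments orthantN : clear implicits.

(** * Uniform estimates on bounded sets *)

Section boxes.
Context (R : realType).
Local Notation T := (measurableTypeR R).

Definition box N (K : R) : set (realvec R N) := [set t | forall i, 0 <= vcoord t i <= K].
Arguments box : clear implicits.

Lemma measurable_box N K : measurable (box N K).
Proof.
rewrite (_ : box N K = \bigcap_(i in [set: 'I_N]) ((fun t => vcoord t i : T) @^-1` `[0, K])).
  apply: fin_bigcap_measurable => // i _.
  by rewrite -[X in measurable X]setTI; exact: measurable_vcoord.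
apply/seteqP; split=> t /= t0 i => [_|]; first by rewrite /= in_itv /= t0.
by have := t0 i Logic.I; rewrite /= in_itv.
Qed.

Lemma lebesgue_box_fin N K : (lebesgue_vec R N (box N K) < +oo)%E.
Proof.
elim: N => [|N IHN].
  by rewrite -[X in (X < _)%E]/(\d_([tuple] : realvec R 0) _) /= diracE ltry.
rewrite -[X in (X < _)%E]/((@lebesgue_measure R \x lebesgue_vec R N)%E (@consvec R N @^-1` box N.+1 K)).
rewrite (_ : _ @^-1` _ = `[0, K] `*` box N K).
  rewrite product_measure1E//=; last exact: measurable_box.
  rewrite lebesgue_measure_itv /= lte_fin; case: ifP => K0; last by rewrite mul0e ltry.
  by rewrite -EFinB lte_mul_pinfty// lee_fin subr0 ltW.
apply/seteqP; split=> -[x t] /= => [xt|[x0 t0] i].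
  split; first by have := xt ord0; rewrite vcoord_consvec0 in_itv.
  by move=> i; have := xt (lift ord0 i); rewrite vcoord_consvecS.
case: (unliftP ord0 i) => [j|] ->; rewrite ?vcoord_consvec0 ?vcoord_consvecS//.
Qed.

End boxes.
Arguments box : clear implicits.

Section exponential_tail.
Context (R : realType).

Definition exp_tail (S : R) p : R := expR S - \sum_(0 <= k < p) S ^+ k / k`!%:R.

(** The tail is a power series with nonnegative coefficients, hence increasing for S >= 0. A bound
    on the amplitude thus gives one error estimate for a whole box. *)
Lemma le_exp_tail S K p : 0 <= S <= K -> exp_tail S p <= exp_tail K p.
Proof.
move=> /andP[S0 SK].
pose u (X : R) n := \sum_(0 <= k < n) X ^+ k / k`!%:R.
suff : u K p - u S p <= expR K - expR S by rewrite /exp_tail /u; lra.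
have cS : u K n - u S n @[n --> \oo] --> expR K - expR S.
  by apply: cvgB; exact: expR_series.
rewrite -(cvg_lim _ cS)//; apply: limr_ge; first by apply/cvg_ex; eexists; exact: cS.
exists p => // n /= pn; rewrite /u -!sumrB (@big_cat_nat _ _ _ p 0 n)//= lerDl.
apply: sumr_ge0 => k _; rewrite -mulrBl mulr_ge0 ?invr_ge0// subr_ge0.
by apply: lerXn2r; rewrite ?nnegrE// (le_trans S0).
Qed.

(** A prime p > 2 is odd, which excludes -1 from the p-th roots of unity. *)
Lemma exp_tail_small K e : 0 < e -> exists p, [/\ prime p, (2 < p)%N & exp_tail K p < e].
Proof.
move=> e0; have /cvgrPdist_lt /(_ e e0) [n _ ne] := @expR_series R K.
have [p np pp] := prime_above (maxn 2 n).
exists p; split=> //; first exact: leq_ltn_trans (leq_maxl _ _) np.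
apply: le_lt_trans (ler_norm _) _; apply: ne => /=.
exact: leq_trans (leq_maxr _ _) (ltnW np).
Qed.

End exponential_tail.

Section density_function.
Context (R : realType) (V : finType) (q : V -> V -> R[i]) (kappa : R).
Hypotheses (kappa_gt0 : 0 < kappa) (kappaE : cexp (- csum (loop_measure q)) = kappa%:C).
Hypothesis (q_hermitian : hermitian_weight q).
Local Notation T := (measurableTypeR R).
Local Notation N := #|V|.

(** Set to 0 off the orthant, where convergence of the series has not been established; this gives a
    measurable nonnegative function on the whole space. *)
Definition real_density : realvec R N -> R := (fun t => complex.Re (occupation_density q t)) \_ (orthantN R N).

Lemma measurable_vertex_coord v :
  measurable_fun [set: realvec R N] (fun t => vertex_coord t v : T).
Proof. exact: measurable_vcoord. Qed.

Lemma measurable_damping : measurable_fun [set: realvec R N] (damping kappa : _ -> R).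
Proof.
apply: measurable_funM => //; apply: measurableT_comp; first exact: measurable_expR.
by apply: measurable_funN; apply: measurable_sum => v; exact: measurable_vertex_coord.
Qed.

Lemma measurable_soup_coef n : measurable_fun [set: realvec R N]
  (fun t => complex.Re (soup_coef q (fun v => (vertex_coord t v)%:C) n) : R).
Proof.
rewrite (_ : (fun t => _) = fun t => \sum_(a <- words V n)
    complex.Re (n`!%:R^-1 * lincoef q a (wcontent a)) * \prod_(v <- a) vertex_coord t v).
  apply: measurable_sum => a; apply: measurable_funM => //.
  apply: measurable_prod => v _; exact: measurable_vertex_coord.
have ReM (w : R[i]) (r : R) : complex.Re (w * r%:C) = complex.Re w * r.
  by case: w => x y /=; rewrite mulr0 subr0.
apply/funext => t; rewrite /soup_coef mulr_sumr raddf_sum; apply: eq_bigr => a _.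
by rewrite mulrA -ReM rmorph_prod.
Qed.

Lemma measurable_real_density : measurable_fun [set: realvec R N] (real_density : _ -> R).
Proof.
apply/(measurable_restrictT _ _).1; first exact: measurable_orthantN.
apply: (@measurable_fun_cvg _ _ R (orthantN R N) (fun n t => damping kappa t *
  \sum_(0 <= k < n) complex.Re (soup_coef q (fun v => (vertex_coord t v)%:C) k))).
  move=> n; apply: measurable_funTS; apply: measurable_funM; first exact: measurable_damping.
  by apply: measurable_sum => k; exact: measurable_soup_coef.
by move=> t t0; have [] := cvg_occupation_density kappa_gt0 kappaE q_hermitian t0.
Qed.

(** The terms of the series have no sign, but the density lies within any e > 0 of a phase average
    of exponentials of real numbers, which is nonnegative. *)
Lemma real_density_ge0 t : 0 <= real_density t.
Proof.
rewrite /real_density patchE; case: ifPn => // /set_mem t0.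
change (0 <= complex.Re (occupation_density q t)).
have d0 := damping_gt0 kappa_gt0 t.
apply/ler_addgt0Pr => e e0; have ed0 : 0 < e / (damping kappa t * 2) by rewrite divr_gt0// mulr_gt0.
have [p [pp _ tp]] := exp_tail_small (amplitude q t) ed0.
have [om omP] := prime_root_of_unity R[i] pp.
have := density_phase_average kappa_gt0 kappaE q_hermitian t0 (conj_sqrt_coord t0) omP.
set A := (X in `|X - _|); rewrite -/(exp_tail _ _) => dist.
have A0 : 0 <= A.
  apply: mulr_ge0; first exact: ltW.
  apply: mulr_ge0; first by rewrite invr_ge0.
  by apply: sumr_ge0 => j _; exact: expR_ge0.
have be : damping kappa t * (2 * exp_tail (amplitude q t) p) <= e.
  have d2 : 0 < damping kappa t * 2 by rewrite mulr_gt0.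
  by rewrite mulrA mulrC -(ler_pdivlMr _ _ d2) ltW.
have := le_trans (ler_norm _) dist; lra.
Qed.

End density_function.

(** * The law of the squared field *)

(** Integrate both inequalities and let e tend to 0; the integral of g is finite. The inequalities
    add the error term instead of subtracting, so that F and I may be infinite. *)
Lemma eq_integral_approx d (X : measurableType d) (R : realType)
    (m : {measure set X -> \bar R}) (F : X -> \bar R) (g : X -> R) (I : \bar R) :
  measurable_fun setT F -> (forall x, 0 <= F x)%E ->
  measurable_fun setT g -> (forall x, 0 <= g x) -> (\int[m]_x (g x)%:E < +oo)%E ->
  (forall e, 0 < e -> exists2 rho : X -> \bar R,
    [/\ measurable_fun setT rho, (forall x, 0 <= rho x)%E & (\int[m]_x rho x = I)%E] &
    forall x, (rho x <= F x + (e * g x)%:E /\ F x <= rho x + (e * g x)%:E)%E) ->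
  (\int[m]_x F x = I)%E.
Proof.
move=> mF F0 mg g0 goo approx.
have G0 : (0 <= \int[m]_x (g x)%:E)%E by apply: integral_ge0 => x _; rewrite lee_fin.
pose M := fine (\int[m]_x (g x)%:E)%E.
have ME : (\int[m]_x (g x)%:E)%E = M%:E by rewrite fineK// ge0_fin_numE.
have M0 : 0 <= M by rewrite fine_ge0.
have mge e : measurable_fun setT (fun x => (e * g x)%:E).
  by apply/measurable_EFinP; apply: measurable_funM.
have ge0 e x : 0 < e -> (0 <= (e * g x)%:E)%E by move=> e0; rewrite lee_fin mulr_ge0// ltW.
have intg e : 0 < e -> (\int[m]_x (e * g x)%:E = (e * M)%:E)%E.
  move=> e0; rewrite EFinM -ME -ge0_integralZl//; last by rewrite lee_fin ltW.
    by apply/measurable_EFinP.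
  by move=> x _; rewrite lee_fin.
have small e : 0 < e -> exists2 e', 0 < e' & e' * M <= e.
  (* The + 1 keeps the denominator positive when M = 0. *)
  move=> e0; exists (e / (M + 1)); first by rewrite divr_gt0// ltr_wpDl.
  have M1 : 0 < M + 1 by rewrite ltr_wpDl.
  by rewrite mulrAC (ler_pdivrMr _ _ M1) (ler_pM2l e0) lerDl.
apply/eqP; rewrite eq_le; apply/andP; split.
  apply/lee_addgt0Pr => eps /small[e' e'0 e'e].
  have [rho [mr r0 rI] ineq] := approx _ e'0.
  apply: (@le_trans _ _ (\int[m]_x (rho x + (e' * g x)%:E))%E).
    apply: ge0_le_integral => //.
    - by apply: emeasurable_funD.
    - by move=> x _; case: (ineq x).
  rewrite ge0_integralD//; last by move=> x _; exact: ge0.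
  by rewrite rI intg// leeD2l// lee_fin.
apply/lee_addgt0Pr => eps /small[e' e'0 e'e].
have [rho [mr r0 rI] ineq] := approx _ e'0.
rewrite -rI; apply: (@le_trans _ _ (\int[m]_x (F x + (e' * g x)%:E))%E).
  apply: ge0_le_integral => //.
  - by apply: emeasurable_funD.
  - by move=> x _; case: (ineq x).
rewrite ge0_integralD//; last by move=> x _; exact: ge0.
by rewrite intg// leeD2l// lee_fin.
Qed.

Section gaussian_density.
Context (R : realType) (V : finType) (q : V -> V -> R[i]) (kappa : R).
Hypothesis (kappa_gt0 : 0 < kappa).
Hypothesis (kappa_det : \det (1%:M - weight_mx q) = kappa%:C).
Hypothesis (q_hermitian : hermitian_weight q).
Local Notation T := (measurableTypeR R).
Local Notation N := #|V|.

Definition field (z : realvec R N * realvec R N) (v : V) : R[i] := cvec z (enum_rank v).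

Lemma field_sqnorm z v : (field z v)^*%C * field z v = (vertex_coord (cvec_sqnorm z) v)%:C.
Proof.
rewrite /vertex_coord /cvec_sqnorm /field /cvec /vcoord tnth_mktuple /sqnorm2 /=.
by apply/eqP; rewrite eq_complex /=; apply/andP; split; apply/eqP; ring.
Qed.

Lemma sum_enum_rank (S : nmodType) (f : V -> S) : \sum_v f v = \sum_(i < N) f (enum_val i).
Proof.
rewrite (reindex_onto enum_rank enum_val) /=; last by move=> i _; rewrite enum_valK.
by apply: eq_big => [v|v _]; rewrite enum_rankK ?eqxx.
Qed.

Lemma gff_densityE z : complex.Re (gff_density (green_mx q) (cvec z)) =
  damping kappa (cvec_sqnorm z) * expR (hform q (field z)) / pi ^+ N.
Proof.
have expo : - (\sum_(i < N) \sum_(j < N)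
    Num.conj (cvec z i) * invmx (green_mx q) i j * cvec z j) =
    (- \sum_v vertex_coord (cvec_sqnorm z) v + hform q (field z))%:C.
  have hE : (hform q (field z))%:C = sesq q (fun u => (field z u)^*%C) (field z).
    by rewrite (sesq_hermitian_real q_hermitian).
  rewrite rmorphD rmorphN /= hE rmorph_sum /=.
  under [X in _ = - X + _]eq_bigr do rewrite -field_sqnorm.
  rewrite -[RHS]opprK opprD opprK; congr (- _).
  rewrite (sum_enum_rank (fun v => (field z v)^*%C * field z v)) /sesq.
  rewrite (sum_enum_rank (fun u => \sum_v _)) -sumrB; apply: eq_bigr => i _.
  rewrite (sum_enum_rank (fun v => (field z (enum_val i))^*%C * q (enum_val i) v * field z v)).
  rewrite /green_mx invmxK (bigD1 i)//= [in RHS](bigD1 i)//= opprD addrA.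
  rewrite !mxE eqxx /field !enum_valK; congr (_ + _).
    by rewrite mulrBr mulr1 mulrBl.
  rewrite -sumrN; apply: eq_bigr => j ji.
  by rewrite !mxE eq_sym (negbTE ji) sub0r enum_valK mulrN mulNr.
have unitW : 1%:M - weight_mx q \in unitmx.
  by rewrite unitmxE kappa_det unitfE -normr_gt0 normc_def /= ltcR expr0n addr0 sqrtr_sqr normr_gt0 gt_eqF.
have cexpE (x : R) : cexp x%:C = (expR x)%:C :> R[i].
  by rewrite /cexp /= cos0 sin0 -[RHS]mulr1.
pose x := - \sum_v vertex_coord (cvec_sqnorm z) v + hform q (field z).
have -> : gff_density (green_mx q) (cvec z) = (expR x / (pi ^+ N * kappa^-1))%:C.
  rewrite /gff_density expo cexpE /green_mx det_inv kappa_det.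
  by rewrite rmorphM fmorphV rmorphM fmorphV.
rewrite /= /damping /x expRD invfM invrK.
by rewrite [_ * kappa]mulrC mulrA [_ * kappa]mulrC !mulrA.
Qed.

Definition phase_cos p (om : R[i]) (j : {ffun V -> 'I_p}) (i : 'I_N) : R :=
  complex.Re (om ^+ j (enum_val i)).
Definition phase_sin p (om : R[i]) (j : {ffun V -> 'I_p}) (i : 'I_N) : R :=
  complex.Im (om ^+ j (enum_val i)).

Lemma field_rotation p om (j : {ffun V -> 'I_p}) z :
  field (cvec_rotation (phase_cos om j) (phase_sin om j) z) = rotate (field z) om j.
Proof.
apply/funext => v; rewrite /field /cvec /rotate /= /vcoord !tnth_mktuple.
rewrite /phase_cos /phase_sin enum_rankK; case: (om ^+ _) => a b.
by apply/eqP; rewrite eq_complex /=; apply/andP; split; apply/eqP; ring.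
Qed.

Lemma phase_cos_sin p om (j : {ffun V -> 'I_p}) i : p.-primitive_root om ->
  phase_cos om j i ^+ 2 + phase_sin om j i ^+ 2 = 1.
Proof.
move=> omP; have := norm_unity_root omP => /(congr1 (fun x => x ^+ j (enum_val i))).
rewrite -normrX expr1n normc_def /phase_cos /phase_sin => /(@complexI R).
by move=> /(congr1 (fun x => x ^+ 2)); rewrite sqr_sqrtr ?expr1n// addr_ge0 ?sqr_ge0.
Qed.

(** A cosine equal to -1 forces a power of om to be -1, and for odd p its p-th power would be -1
    instead of 1. *)
Lemma phase_cos_neqN1 p om (j : {ffun V -> 'I_p}) i : p.-primitive_root om -> odd p ->
  phase_cos om j i != -1.
Proof.
move=> omP p_odd; apply/eqP => cN1; have cs := phase_cos_sin j i omP.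
have s0 : phase_sin om j i = 0.
  by apply/eqP; rewrite -sqrf_eq0; apply/eqP; move: cs; rewrite cN1; lra.
have omN1 : om ^+ j (enum_val i) = -1.
  apply/eqP; rewrite eq_complex /= oppr0; apply/andP; split; apply/eqP.
    exact: cN1.
  exact: s0.
have := congr1 (fun x => x ^+ p) omN1; rewrite exprAC (prim_expr_order omP) expr1n.
rewrite -signr_odd p_odd expr1 => /eqP; rewrite -addr_eq0 -mulr2n pnatr_eq0.
by [].
Qed.

Lemma cvec_sqnorm_rotation p om (j : {ffun V -> 'I_p}) z : p.-primitive_root om ->
  cvec_sqnorm (cvec_rotation (phase_cos om j) (phase_sin om j) z) = cvec_sqnorm z.
Proof.
move=> omP; apply: eq_from_tnth => i; rewrite /cvec_sqnorm !tnth_mktuple.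
rewrite /cvec_rotation /vcoord /= !tnth_mktuple.
move: (tnth z.1 i) (tnth z.2 i) (phase_cos_sin j i omP) => x y.
move: (phase_cos _ _ _) (phase_sin _ _ _) => c s cs; rewrite /sqnorm2 /=.
transitivity ((c ^+ 2 + s ^+ 2) * (x ^+ 2 + y ^+ 2)); first by ring.
by rewrite cs mul1r.
Qed.

End gaussian_density.

Lemma sume_const (R : realType) (I : finType) (x : \bar R) :
  (\sum_(i : I) x = #|I|%:R%:E * x)%E.
Proof.
rewrite big_const; elim: #|I| => [|n IHn] /=; first by rewrite mul0e.
by rewrite IHn -[in RHS]add1n natrD EFinD ge0_muleDl ?mul1e ?lee_fin ?ler0n.
Qed.

Section law_of_sqnorm.
Context (R : realType) (V : finType) (q : V -> V -> R[i]) (kappa : R).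
Hypotheses (kappa_gt0 : 0 < kappa) (kappaE : cexp (- csum (loop_measure q)) = kappa%:C).
Hypothesis (q_hermitian : hermitian_weight q).
Local Notation T := (measurableTypeR R).
Local Notation N := #|V|.
Local Notation L := (lebesgue_vec R N).
Local Notation f := (real_density q).

Definition gauss_density (z : realvec R N * realvec R N) : R :=
  damping kappa (cvec_sqnorm z) * expR (hform q (field z)) / pi ^+ N.

Lemma gauss_density_ge0 z : 0 <= gauss_density z.
Proof.
rewrite divr_ge0 ?exprn_ge0 ?pi_ge0// mulr_ge0 ?expR_ge0// ltW//.
exact: damping_gt0.
Qed.

Lemma measurable_hform_field : measurable_fun setT (fun z => hform q (field z) : R).
Proof.
rewrite (_ : (fun z => _) = fun z : realvec R N * realvec R N => \sum_u \sum_v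
   (complex.Re (q u v) * (vertex_coord z.1 u * vertex_coord z.1 v + vertex_coord z.2 u * vertex_coord z.2 v)
   - complex.Im (q u v) * (vertex_coord z.1 u * vertex_coord z.2 v - vertex_coord z.2 u * vertex_coord z.1 v))).
  have m1 v : measurable_fun setT (fun z : realvec R N * realvec R N => vertex_coord z.1 v : R).
    exact: (measurableT_comp (measurable_vertex_coord v)).
  have m2 v : measurable_fun setT (fun z : realvec R N * realvec R N => vertex_coord z.2 v : R).
    exact: (measurableT_comp (measurable_vertex_coord v)).
  apply: measurable_sum => u; apply: measurable_sum => v.
  apply: measurable_funB; apply: measurable_funM => //.
    by apply: measurable_funD; apply: measurable_funM.
  by apply: measurable_funB; apply: measurable_funM.
apply/funext => z; rewrite /hform /sesq raddf_sum; apply: eq_bigr => u _.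
rewrite raddf_sum; apply: eq_bigr => v _; rewrite /field /cvec /vertex_coord.
by case: (q u v) => a b /=; ring.
Qed.

Lemma measurable_gauss_density : measurable_fun setT (gauss_density : _ -> R).
Proof.
apply: measurable_funM => //; apply: measurable_funM.
  exact: (measurableT_comp (measurable_damping kappa) (@measurable_cvec_sqnorm R N)).
by apply: measurableT_comp; [exact: measurable_expR|exact: measurable_hform_field].
Qed.

Definition box_amplitude (K : R) : R := \sum_u \sum_v Normc.normc (q u v) * K.

Lemma amplitude_box K t : box R N K t -> amplitude q t <= box_amplitude K.
Proof.
move=> tK; rewrite -lecR -sesq_norm_real rmorph_sum; apply: ler_sum => u _.
rewrite rmorph_sum; apply: ler_sum => v _ /=; rewrite rmorphM /=.
rewrite (_ : (Normc.normc (q u v))%:C = `|q u v|); last by rewrite normc_def; case: (q u v).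
have K0 : 0 <= K by have /andP[t0] := tK (enum_rank u); exact: le_trans.
rewrite [X in X * _]mulrC -mulrA /abs_weight ler_wpM2l// !ger0_norm ?lecR ?sqrtr_ge0// -rmorphM lecR.
rewrite -(sqr_sqrtr K0) expr2 ler_pM ?sqrtr_ge0// ler_wsqrtr//.
  by have /andP[] := tK (enum_rank u).
by have /andP[] := tK (enum_rank v).
Qed.

Lemma damping_le t : orthantN R N t -> damping kappa t <= kappa.
Proof.
move=> t0; rewrite /damping -[leRHS]mulr1 ler_pM2l// -expR0 ler_expR oppr_le0.
by apply: sumr_ge0 => v _; exact: t0.
Qed.

Lemma box_orthant K t : box R N K t -> orthantN R N t.
Proof. by move=> tK i; have /andP[] := tK i. Qed.

Let piN_gt0 : 0 < pi ^+ N :> R. Proof. by rewrite exprn_gt0// pi_gt0. Qed.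

Lemma orthant_cvec_sqnorm z : orthantN R N (cvec_sqnorm z).
Proof. by move=> i; rewrite /vcoord tnth_mktuple sqnorm2_ge0. Qed.

Section bounded_sets.
Variables (A : set (realvec R N)) (K : R).
Hypotheses (mA : measurable A) (AK : A `<=` box R N K).

Let g (z : realvec R N * realvec R N) : R := \1_A (cvec_sqnorm z).

Let mg : measurable_fun setT (g : _ -> R).
Proof. exact: (measurableT_comp (measurable_indic mA) (@measurable_cvec_sqnorm R N)). Qed.

Let g0 z : 0 <= g z. Proof. by rewrite /g indicE. Qed.

Let integral_g : (\int[L \x L]_z (g z)%:E < +oo)%E.
Proof.
have mi : measurable_fun setT (fun t => (\1_A t)%:E : \bar R).
  by apply/measurable_EFinP; exact: measurable_indic.
rewrite (integral_cvec_sqnorm mi) => [|t]; last by rewrite lee_fin indicE.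
rewrite integral_indic//; last exact: measurable_orthantN.
apply: lte_mul_pinfty; rewrite ?lee_fin ?ltW//.
apply: le_lt_trans (lebesgue_box_fin N K); apply: le_measure; rewrite ?inE.
- by apply: measurableI => //; exact: measurable_orthantN.
- exact: measurable_box.
- by move=> t [/AK].
Qed.

(** The density f, cut off to A and lifted to C^N as a function of the |z_v|^2 only. It is what the
    average of [rhoA] over all rotations of phases approximates. *)
Let F z : \bar R := (f (cvec_sqnorm z) * g z / pi ^+ N)%:E.

Let mf := measurable_real_density kappa_gt0 kappaE q_hermitian.
Let f0 := real_density_ge0 kappa_gt0 kappaE q_hermitian.

Let integral_F : (\int[L \x L]_z F z = \int[L]_(t in A) (f t)%:E)%E.
Proof.
pose h t : \bar R := (f t * \1_A t / pi ^+ N)%:E.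
have mh : measurable_fun setT h.
  apply/measurable_EFinP; apply: measurable_funM => //; apply: measurable_funM; first exact: mf.
  exact: measurable_indic.
have h0 t : (0 <= h t)%E by rewrite lee_fin; apply: divr_ge0; [rewrite mulr_ge0 ?f0// indicE|exact: ltW].
rewrite (integral_cvec_sqnorm mh h0) -ge0_integralZl//; last 3 first.
- exact: measurable_orthantN.
- exact: measurable_funTS.
- by rewrite lee_fin ltW.
rewrite integral_mkcond [RHS]integral_mkcond; apply: eq_integral => t _.
rewrite !patchE /h; case: ifPn => [|tO].
  rewrite inE => tO; rewrite -EFinM mulrC divfK ?gt_eqF// indicE.
  by case: ifP => _; rewrite ?mulr1 ?mulr0.
rewrite ifN//; apply: contra tO; rewrite !inE => /AK; exact: box_orthant.
Qed.

Let rhoA z : R := gauss_density z * g z.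

Let mrhoA : measurable_fun setT (rhoA : _ -> R).
Proof. by apply: measurable_funM => //; exact: measurable_gauss_density. Qed.

Let rhoA0 z : 0 <= rhoA z. Proof. by rewrite mulr_ge0// gauss_density_ge0. Qed.

Let integral_rhoA :
  (\int[L \x L]_(z in @cvec_sqnorm R N @^-1` A) (gauss_density z)%:E = \int[L \x L]_z (rhoA z)%:E)%E.
Proof.
rewrite integral_mkcond; apply: eq_integral => z _; rewrite patchE /rhoA /g indicE.
have -> : (z \in @cvec_sqnorm R N @^-1` A) = (cvec_sqnorm z \in A) by apply/idP/idP; rewrite !inE.
by case: ifP => _; rewrite ?mulr1 ?mulr0.
Qed.

(** Averaging [rhoA] over rotations by roots of unity keeps its integral, since each rotation
    preserves Lebesgue measure and the cutoff to A. On the box the average is uniformly close to F,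
    so F has that same integral; the radial formula evaluates it as the integral of f over A. *)
Lemma law_sqnorm_bounded :
  (\int[L \x L]_(z in @cvec_sqnorm R N @^-1` A) (gauss_density z)%:E =
   \int[L]_(t in A) (f t)%:E)%E.
Proof.
rewrite integral_rhoA -integral_F; apply/esym.
apply: eq_integral_approx mg g0 integral_g _.
- apply/measurable_EFinP; apply: measurable_funM; last exact: measurable_cst.
  apply: measurable_funM; last exact: mg.
  exact: (measurableT_comp mf (@measurable_cvec_sqnorm R N)).
- by move=> z; rewrite lee_fin; apply: divr_ge0; [rewrite mulr_ge0 ?f0|exact: ltW].
move=> e e0.
(* The damping factor is at most kappa on the orthant, the series estimate costs a factor 2, and the
   densities carry 1 / pi^N; this tolerance makes the resulting error at most e. *)
have e'0 : 0 < e * pi ^+ N / (kappa * 2) by rewrite !mulr_gt0 ?invr_gt0 ?mulr_gt0.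
have [p [pp p2 tail_e]] := exp_tail_small (box_amplitude K) e'0.
have [om omP] := prime_root_of_unity R[i] pp.
have p_odd : odd p by have [] := even_prime pp => // pE; rewrite pE in p2.
have M0 : (p ^ N)%:R != 0 :> R by rewrite pnatr_eq0 expn_eq0 negb_and -lt0n prime_gt0.
pose rot (j : {ffun V -> 'I_p}) z := cvec_rotation (phase_cos om j) (phase_sin om j) z.
have mrot j : measurable_fun setT (fun z => (rhoA (rot j z))%:E).
  apply/measurable_EFinP; apply: (measurableT_comp mrhoA).
  exact: (measurable_cvec_rotation (phase_cos om j) (phase_sin om j)).
exists (fun z => ((p ^ N)%:R^-1 %:E * \sum_(j : {ffun V -> 'I_p}) (rhoA (rot j z))%:E)%E).
  have msum : measurable_fun setT
      (fun z => \sum_(j : {ffun V -> 'I_p}) (rhoA (rot j z))%:E : \bar R)%E.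
    exact: emeasurable_sum.
  have sum0 z : (0 <= \sum_(j : {ffun V -> 'I_p}) (rhoA (rot j z))%:E)%E.
    by apply: sume_ge0 => j _; rewrite lee_fin.
  have Mi0 : (0 <= (p ^ N)%:R^-1%:E :> \bar R)%E by rewrite lee_fin invr_ge0.
  split.
  - exact: measurable_funeM.
  - by move=> z; rewrite mule_ge0.
  rewrite (ge0_integralZl _ measurableT msum (fun z _ => sum0 z) Mi0).
  rewrite ge0_integral_sum//; last by move=> j z _; rewrite lee_fin.
  rewrite (eq_bigr (fun=> \int[L \x L]_z (rhoA z)%:E)%E); last first.
    move=> j _; apply: (integral_cvec_rotation (f := fun z => (rhoA z)%:E)).
    + by move=> i; exact: phase_cos_sin.
    + by move=> i; exact: phase_cos_neqN1.
    + exact/measurable_EFinP.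
    + by move=> z; rewrite lee_fin.
  rewrite sume_const card_ffun card_ord muleA -EFinM mulVf//.
  by rewrite mul1e.
move=> z; set d := damping kappa (cvec_sqnorm z).
pose avg := (p ^ N)%:R^-1 * \sum_(j : {ffun V -> 'I_p}) expR (hform q (rotate (field z) om j)).
have -> : ((p ^ N)%:R^-1%:E * \sum_(j : {ffun V -> 'I_p}) (rhoA (rot j z))%:E)%E =
    (d * avg / pi ^+ N * g z)%:E.
  have -> : (\sum_(j : {ffun V -> 'I_p}) (rhoA (rot j z))%:E =
      (d / pi ^+ N * g z * \sum_(j : {ffun V -> 'I_p}) expR (hform q (rotate (field z) om j)))%:E)%E.
    rewrite sumEFin [in RHS]mulr_sumr; congr _%:E; apply: eq_bigr => j _.
    by rewrite /rhoA /gauss_density /g /rot (cvec_sqnorm_rotation _ _ omP) field_rotation -/d; ring.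
  by rewrite -EFinM /avg; congr _%:E; ring.
rewrite /F -!EFinD !lee_fin /g indicE; case: (boolP (cvec_sqnorm z \in A)) => [|_]; last by rewrite !mulr0 ?mul0r ?add0r.
rewrite inE !mulr1 => zA; have zO := orthant_cvec_sqnorm z.
have fE : f (cvec_sqnorm z) = complex.Re (occupation_density q (cvec_sqnorm z)).
  by rewrite /real_density patchE mem_set.
have := density_phase_average kappa_gt0 kappaE q_hermitian zO (field_sqnorm z) omP.
rewrite -/(exp_tail (amplitude q (cvec_sqnorm z)) p) -fE -/d -/avg => dist.
have tail0 : 0 <= exp_tail (amplitude q (cvec_sqnorm z)) p.
  by rewrite subr_ge0 expR_partial_le// amplitude_ge0.
have tail_le : exp_tail (amplitude q (cvec_sqnorm z)) p <= e * pi ^+ N / (kappa * 2).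
  apply: le_trans (ltW tail_e); apply: le_exp_tail.
  by rewrite amplitude_ge0 (amplitude_box (AK zA)).
have d0 : 0 <= d by rewrite ltW// damping_gt0.
have be : d * (2 * exp_tail (amplitude q (cvec_sqnorm z)) p) <= e * pi ^+ N.
  apply: (@le_trans _ _ (kappa * (2 * (e * pi ^+ N / (kappa * 2))))).
    by apply: ler_pM => //; [rewrite mulr_ge0|exact: damping_le|rewrite ler_pM2l].
  have k0 : kappa != 0 by rewrite gt_eqF.
  by rewrite (_ : kappa * (2 * (e * pi ^+ N / (kappa * 2))) = e * pi ^+ N)//; field.
have := le_trans dist be; rewrite ler_norml => /andP[h1 h2].
have eE : e = e * pi ^+ N / pi ^+ N by rewrite mulfK// gt_eqF.
rewrite [X in _ <= _ + X]eE [X in _ /\ _ <= _ + X]eE -!mulrDl !ler_pM2r ?invr_gt0//.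
by split; lra.
Qed.

End bounded_sets.
End law_of_sqnorm.

Section law.
Context (R : realType) (V : finType) (q : V -> V -> R[i]) (kappa : R).
Hypotheses (kappa_gt0 : 0 < kappa) (kappaE : cexp (- csum (loop_measure q)) = kappa%:C).
Hypothesis (q_hermitian : hermitian_weight q).
Local Notation T := (measurableTypeR R).
Local Notation N := #|V|.
Local Notation L := (lebesgue_vec R N).
Local Notation f := (real_density q).

Lemma bigcup_box : \bigcup_n box R N n%:R = orthantN R N.
Proof.
apply/seteqP; split=> [t [n _]|t t0]; first exact: box_orthant.
(* On the orthant every coordinate is at most the sum of all of them. *)
exists (Num.truncn (\sum_i vcoord t i)).+1 => // i /=; rewrite t0/=.
apply: le_trans (ltW (truncnS_gt _)).
by rewrite (bigD1 i)//= lerDl; apply: sumr_ge0 => j _; exact: t0.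
Qed.

(** Both densities are nonnegative, so monotone convergence along the boxes [0,n]^N removes the
    boundedness of A. The values |z_v|^2 lie in the orthant, hence nothing is lost on the Gaussian
    side. *)
Lemma law_sqnorm A : measurable A ->
  (\int[L \x L]_(z in @cvec_sqnorm R N @^-1` A) (gauss_density q kappa z)%:E =
   \int[L]_(t in A `&` orthantN R N) (f t)%:E)%E.
Proof.
move=> mA; pose B n := A `&` box R N n%:R.
have mB n : measurable (B n) by apply: measurableI => //; exact: measurable_box.
have ndB : nondecreasing_seq B.
  apply/nondecreasing_seqP => n; apply/subsetPset => t [At tn]; split => // i.
  by have /andP[-> /= /le_trans->] := tn i; rewrite ?ler_nat.
have BE : \bigcup_n B n = A `&` orthantN R N by rewrite -setI_bigcupr bigcup_box.
have preE : \bigcup_n (@cvec_sqnorm R N @^-1` B n) = @cvec_sqnorm R N @^-1` A.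
  rewrite -preimage_bigcup BE; apply/seteqP; split=> z; first by case.
  move=> Az; split=> //.
  exact: orthant_cvec_sqnorm.
have cvgR : (\int[L]_(t in B n) (f t)%:E @[n --> \oo] -->
    \int[L]_(t in A `&` orthantN R N) (f t)%:E)%E.
  rewrite -BE; apply: ge0_nondecreasing_set_cvg_integral => [//|//|n|n t _].
    apply: measurable_funTS; apply/measurable_EFinP.
    exact: (measurable_real_density kappa_gt0 kappaE q_hermitian).
  by rewrite lee_fin (real_density_ge0 kappa_gt0 kappaE q_hermitian).
have cvgL : (\int[L \x L]_(z in @cvec_sqnorm R N @^-1` B n) (gauss_density q kappa z)%:E
    @[n --> \oo] --> \int[L \x L]_(z in @cvec_sqnorm R N @^-1` A) (gauss_density q kappa z)%:E)%E.
  rewrite -preE; apply: ge0_nondecreasing_set_cvg_integral => [m n mn|n|n|n z _].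
  - by apply/subsetPset => z; have /subsetPset := ndB _ _ mn; exact.
  - by rewrite -[X in measurable X]setTI; exact: measurable_cvec_sqnorm.
  - apply: measurable_funTS; apply/measurable_EFinP; exact: measurable_gauss_density.
  - by rewrite lee_fin gauss_density_ge0.
have seqE : (fun n => \int[L \x L]_(z in @cvec_sqnorm R N @^-1` B n) (gauss_density q kappa z)%:E)%E =
    (fun n => \int[L]_(t in B n) (f t)%:E)%E.
  apply/funext => n; apply: (law_sqnorm_bounded kappa_gt0 kappaE q_hermitian (mB n)).
  exact: subIsetr.
rewrite seqE in cvgL.
by rewrite -(cvg_lim _ cvgL)// -(cvg_lim _ cvgR).
Qed.

End law.

(** [csum] and [cintegral] return a number for every family and every function. The first three
    conclusions ensure that those entering [occupation_field] are genuine sums and integrals. *)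
Theorem mainTheorem2 (R : realType) (V : finType) (V_gt0 : (0 < #|V|)%N)
    (q : V -> V -> R[i])
    (q_integrable : integrable_weight q) (q_hermitian : hermitian_weight q)
    (d : measure_display) (Omega : measurableType d) (P : probability Omega R)
    (Z : V -> Omega -> R[i]) (Z_gff : is_gff Z P (green_mx q)) :
  [/\ csummable (loop_measure q),
      forall t, orthant t -> csummable (occupation_term q t),
      cintegrable (lebesgue_vec R #|V|) (@orthant R V) (occupation_density q)
    & forall A : set (realvec R #|V|), measurable A ->
        occupation_field q A = (fine (pushforward P (sqnorm_field Z) A))%:C].
Proof.
have [kappa kappa_gt0 [kappaE kappa_det]] := cexp_loop_mass q_integrable q_hermitian.
have [mZ lawZ] := Z_gff.
pose L := lebesgue_vec R #|V|; pose O := orthantN R #|V|; pose f := real_density q.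
have mO : measurable O by exact: measurable_orthantN.
have mf : measurable_fun setT (fun t => (f t)%:E).
  by apply/measurable_EFinP; exact: (measurable_real_density kappa_gt0 kappaE q_hermitian).
have f0 t : 0 <= f t by exact: (real_density_ge0 kappa_gt0 kappaE q_hermitian).
have densE t : orthant t -> occupation_density q t = (f t)%:C.
  move=> t0; have [_ ->] := cvg_occupation_density kappa_gt0 kappaE q_hermitian t0.
  by rewrite /f /real_density patchE mem_set.
have sqZ : sqnorm_field Z = @cvec_sqnorm R #|V| \o reim_field Z.
  apply/funext => w; apply: eq_from_tnth => i; rewrite !tnth_mktuple.
  rewrite /vcoord /= !tnth_mktuple /sqnorm2; case: (Z _ w) => a b /=; ring.
have law A : measurable A ->
    pushforward P (sqnorm_field Z) A = (\int[L]_(t in A `&` O) (f t)%:E)%E.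
  move=> mA; rewrite /pushforward sqZ comp_preimage -[LHS]/(pushforward P _ _) lawZ; last first.
    by rewrite -[X in measurable X]setTI; exact: measurable_cvec_sqnorm.
  rewrite -(law_sqnorm kappa_gt0 kappaE q_hermitian mA); apply: eq_integral => z _.
  by rewrite (gff_densityE kappa_gt0 kappa_det q_hermitian).
split.
- exact: csummable_loop_measure.
- by move=> t t0; exact: (csummable_occupation_term kappa_gt0 kappaE).
- split.
    apply/integrableP; split.
      apply: (eq_measurable_fun (fun t => (f t)%:E)) => [t|]; last exact: measurable_funTS.
      by rewrite inE => /densE ->.
    rewrite (eq_integral (fun t => (f t)%:E)) => [|t]; last first.
      rewrite inE => /densE -> /=; rewrite ger0_norm; [reflexivity|exact: f0].
    (* Applied to the whole space, the law identifies the integral of f with the total mass of P,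
       which is finite. *)
    have := law setT measurableT; rewrite setTI => <-.
    by rewrite /pushforward preimage_setT probability_setT ltry.
  apply: (eq_integrable _ (fun=> 0)%E) => // [t|]; last exact: integrable0.
  by rewrite inE => /densE ->.
- move=> A mA; rewrite /occupation_field /cintegral law//.
  have imE : Rintegral L (A `&` @orthant R V) (fun t => complex.Im (occupation_density q t)) = 0.
    rewrite /Rintegral (eq_integral (fun=> 0)%E) ?integral0// => t.
    by rewrite inE => -[_ /densE ->].
  rewrite imE /Rintegral; congr (fine _ +i* _).
  by apply: eq_integral => t; rewrite inE => -[_ /densE ->].
Qed.
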